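(* (1) Let $m$ be a nonzero cube-free integer, let $C: U^3+V^3=m$ and $C': U'V'(U'+V')=m$, and let $R\in C(\mathbb{Q})$ be a nontorsion point which is the image of a point of $C'(\mathbb{Q})$ under the $3$-isogeny $\tau:C'\to C$. Then $W_n$ is not a prime power for any $n>1$. (2) There is an absolute constant $K$ such that for all $m$ and $R$ satisfying the hypotheses in (1), the number of indices $n\ge 1$ for which $W_n$ has at most two distinct prime divisors is at most $K$.
   Context: For a nonzero integer $m$, let $C$ be the elliptic curve $C: U^3+V^3=m$ over $\mathbb{Q}$. Its group law is given by the chord and tangent method: the identity is the point at infinity with homogeneous coordinates $(1:-1:0)$, and inversion is reflection in the line $U=V$. For a nontorsion point $R\in C(\mathbb{Q})$ and $n\ge 1$, write, in lowest terms, $$nR=\left(\frac{U_n}{W_n},\frac{V_n}{W_n}\right),$$ with $U_n,V_n,W_n\in\mathbb{Z}$ and $W_n\ge 1$. An integer is cube-free if it is not divisible by the cube of any prime. A prime power is an integer $p^k$ with $p$ prime and $k\ge1$. ''Absolute'' means independent of $m$ and $R$. The $3$-isogeny $\tau:C'\to C$ from the elliptic curve $C': U'V'(U'+V')=m$ sends the points at infinity of $C'$ to the identity of $C$ and is given on affine points $(u,v)\in C'(\mathbb{Q})$ by $$\tau(u,v)=\left(\frac{-u^3+3u^2v+6uv^2+v^3}{3(u^2+uv+v^2)},\ \frac{u^3+6u^2v+3uv^2-v^3}{3(u^2+uv+v^2)}\right).$$ Equivalently, the condition that $R=(U,V)$ lies in $\tau(C'(\mathbb{Q}))$ says that the point $P=(X,Y)$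 with $X=\frac{12m}{U+V}$, $Y=\frac{36m(U-V)}{U+V}$ on $E:Y^2=X^3-432m^2$ equals $\sigma(P')$ for some $P'\in E'(\mathbb{Q})$, where $E':y^2=x^3+16m^2$ and $\sigma:E'\to E$ is the $3$-isogeny $\sigma(x,y)=\left(x+\frac{64m^2}{x^2},\ \frac{y(y+12m)(y-12m)}{(y+4m)(y-4m)}\right)$. *)

(* Defs.v *)
From mathcomp Require Import all_boot all_order all_algebra.

Set Implicit Arguments.
Unset Strict Implicit.
Unset Printing Implicit Defensive.

Import Order.TTheory GRing.Theory Num.Theory.
Local Open Scope ring_scope.

(* A rational point of C : U^3 + V^3 = m; over Q the only point at infinity
   is (1 : -1 : 0), and it is the identity of the group law. *)
Inductive cpoint : Type := Cinf | Caff of rat & rat.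

Definition on_C (m : int) (P : cpoint) : Prop :=
  if P is Caff u v then u ^+ 3 + v ^+ 3 = m%:~R else True.

Definition copp (P : cpoint) : cpoint :=
  if P is Caff u v then Caff v u else Cinf.

(* Third intersection with C of the line through the affine points (u1, v1)
   and (u2, v2), or of the tangent line when they coincide. The line is
   parametrized as (u1 + t * a, v1 + t * b). On it U^3 + V^3 - m is
     (a^3 + b^3) t^3 + 3 (u1 a^2 + v1 b^2) t^2 + 3 (u1^2 a + v1^2 b) t,
   of which t = 0 and t = t0 are two roots. The leading coefficient vanishes
   (over Q) iff a + b = 0, iff the line passes through (1 : -1 : 0).
   The parameter m is determined by (u1, v1), so it does not occur. *)
Definition third_affine (u1 v1 u2 v2 : rat) : cpoint :=
  let tangent := (u1 == u2) && (v1 == v2) in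
  let a := if tangent then v1 ^+ 2 else u2 - u1 in
  let b := if tangent then - u1 ^+ 2 else v2 - v1 in
  let t0 := if tangent then 0 else 1 in
  if a + b == 0 then Cinf else
  let t := - (3 * (u1 * a ^+ 2 + v1 * b ^+ 2) / (a ^+ 3 + b ^+ 3)) - t0 in
  Caff (u1 + t * a) (v1 + t * b).

(* The point at infinity is a flex, and a line U + V = c through it meets C
   in the further points (u, v) and (v, u). *)
Definition third_point (P Q : cpoint) : cpoint :=
  match P, Q with
  | Cinf, Q => copp Q
  | P, Cinf => copp P
  | Caff u1 v1, Caff u2 v2 => third_affine u1 v1 u2 v2
  end.

Definition cadd (P Q : cpoint) : cpoint := copp (third_point P Q).

Definition cmuln (n : nat) (P : cpoint) : cpoint := iter n (cadd P) Cinf.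

Definition nontorsion (P : cpoint) : Prop :=
  forall n : nat, (0 < n)%N -> cmuln n P <> Cinf.

(* A rational point of C' : U'V'(U' + V') = m; the points at infinity are
   (1 : 0 : 0), (0 : 1 : 0) and (1 : -1 : 0). *)
Inductive c'point : Type := C'inf100 | C'inf010 | C'inf1m10 | C'aff of rat & rat.

Definition on_C' (m : int) (P : c'point) : Prop :=
  if P is C'aff u v then u * v * (u + v) = m%:~R else True.

Definition tau (P : c'point) : cpoint :=
  if P is C'aff u v then
    let d := 3 * (u ^+ 2 + u * v + v ^+ 2) in
    Caff ((- u ^+ 3 + 3 * u ^+ 2 * v + 6 * u * v ^+ 2 + v ^+ 3) / d)
         ((u ^+ 3 + 6 * u ^+ 2 * v + 3 * u * v ^+ 2 - v ^+ 3) / d)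
  else Cinf.

Definition in_tau_image (m : int) (R : cpoint) : Prop :=
  exists2 P : c'point, on_C' m P & tau P = R.

Definition cube_free (m : int) : Prop :=
  forall p : nat, prime p -> ~ ((p ^ 3)%N%:Z %| m)%Z.

Definition prime_power (a : int) : Prop :=
  exists p k : nat, [/\ prime p, (0 < k)%N & a = (p ^ k)%N%:Z].

Definition lowest_terms (P : cpoint) (U V W : int) : Prop :=
  [/\ P = Caff (U%:~R / W%:~R) (V%:~R / W%:~R), 1 <= W
    & gcdz (gcdz U V) W = 1].

(* Main.v *)
Require Import Defs.
From mathcomp Require Import all_boot all_order all_algebra.
From mathcomp Require Import classical_sets cardinality.
From mathcomp Require Import ring lra zify.

(** The proof rests on a height that satisfies a parallelogram inequality with
    no error term.

    Let tau P = R with P on C' : UV(U+V) = m, and let (a_n : b_n : d_n) be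
    primitive integer coordinates of nP, so that ab(a+b) = m d^3. As m is
    cube-free, a, b and a+b are pairwise coprime. Hence N = a^2 + ab + b^2 is
    coprime to m and to d; moreover 9 never divides N. Let T be N without its
    possible factor 3. The formula for tau gives W_n = |d_n| T_n or 3 |d_n| T_n,
    according to whether 3 divides N_n or not ([denom_formula], [W_core]). The
    identity 4 N^3 = 27 m^2 d^6 + s^2 ([norm_disc]) bounds m and d in terms of N,
    so that N serves as a height.

    The addition on C' is described by the rank-one matrix (P+Q)(P-Q)^T, whose
    entries are polynomials of bidegree (2, 2). Two of its columns suffice to add
    any two points, and associativity is an identity between polynomials. Taking
    norms in both factors ([law_norm]) shows that N(P+Q) N(P-Q) is, up to a power
    of 3, the sum of (N(P) N(Q))^2 and a non-negative term. With the height H = N,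
    or N / 9 if 3 divides N, this becomes H(P+Q) H(P-Q) >= H(P)^2 H(Q)^2
    ([ht_parallelogram]). Consequently H(nP) >= H(P)^(n^2) ([ht_growth]), and
    H(P) >= 4/3 because R is not a torsion point ([ht1_ge]).

    For (1), T_n > 1 is coprime to d_n and to 3, so a prime power W_n forces
    d_n = 1 or -1. Then a_n b_n (a_n + b_n) = m or -m, which implies
    N_n <= |m| + 1, whereas 27 m^2 <= 4 N_1^3. So N_n is at most of the order of
    N_1^(3/2), against the growth of H ([not_prime_power]).

    For (2), K = 4 works: W_n has three prime divisors as soon as n >= 4
    ([three_prime_divisors]). Again d_n is neither 1 nor -1. If n = 3k, the isogeny
    dual to tau gives d_n = U_k V_k W_k up to sign, with U_k V_k, W_k and T_n
    pairwise coprime and not 1 or -1. If 3 does not divide n and T_n is a power of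
    a prime r, then r divides T_1, the point 3P lies in the kernel of reduction
    modulo r, and the formal group yields v_r(T_n) <= v_r(T_1) + v_r(n)
    ([near_logn], [core_logn_le]). So T_n <= n T_1, again against the growth of
    H. *)


Set Implicit Arguments.
Unset Strict Implicit.
Unset Printing Implicit Defensive.
Import Order.TTheory GRing.Theory Num.Theory.
Local Open Scope ring_scope.

(** * Addition laws on the cubic ab(a+b) = m d^3 *)

Section Laws.
Variables (R : comNzRingType) (m : R).
Local Notation vec := (R * R * R)%type.
Implicit Types p q r : vec.

Definition norm_form p := let: (a, b, _) := p in a ^+ 2 + a * b + b ^+ 2.

Definition on_cubic p := let: (a, b, d) := p in a * b * (a + b) = m * d ^+ 3.

Definition vopp p : vec := let: (a, b, d) := p in (b, a, d).

Definition vscale (c : R) p : vec := let: (a, b, d) := p in (c * a, c * b, c * d).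

Definition par p q :=
  let: (a1, b1, d1) := p in let: (a2, b2, d2) := q in
  [/\ a1 * b2 = a2 * b1, a1 * d2 = a2 * d1 & b1 * d2 = b2 * d1].

(** The matrix with columns [law1 p q], [law2 p q] and [law3 p q] is the rank-one
    matrix (p + q)(p - q)^T written with polynomials of bidegree (2, 2). Every
    column is thus proportional to p + q, and a column vanishes exactly when the
    corresponding coordinate of p - q does. For m <> 0, a = b = 0
    forces d = 0 on the curve, so the first two coordinates of p - q are never
    both 0, and the first two columns together describe the addition of any two
    points. *)
Definition law1 p q : vec :=
  let: (a1, b1, d1) := p in let: (a2, b2, d2) := q in
  (- (a1 ^+ 2 * a2 * b2 + b1 * (a1 + b1) * (a2 + b2) ^+ 2
      + 3 * m * d1 * d2 * (a1 * d2 + (a2 + b2) * d1)),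
   (a1 + b1) ^+ 2 * a2 * (a2 + b2) + a1 * b1 * b2 ^+ 2
      + 3 * m * d1 * d2 * ((a1 + b1) * d2 + b2 * d1),
   d2 * (b1 ^+ 2 * (a2 + b2) - a1 ^+ 2 * a2 + 2 * a1 * b1 * b2)
   + d1 * (b1 * b2 ^+ 2 - (a1 + b1) * a2 ^+ 2 - 2 * a1 * a2 * b2)).

Definition law2 p q := vopp (law1 (vopp p) (vopp q)).

Definition law (i : bool) := if i then law1 else law2.

Definition law3 p q : vec :=
  let: (a1, b1, d1) := p in let: (a2, b2, d2) := q in
  (d2 * (b1 ^+ 2 * (a2 + b2) - a1 ^+ 2 * b2 + 2 * a1 * b1 * a2)
   + d1 * (b1 * a2 ^+ 2 - (a1 + b1) * b2 ^+ 2 - 2 * a1 * a2 * b2),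
   d2 * (a1 ^+ 2 * (a2 + b2) - b1 ^+ 2 * a2 + 2 * a1 * b1 * b2)
   + d1 * (a1 * b2 ^+ 2 - (a1 + b1) * a2 ^+ 2 - 2 * b1 * a2 * b2),
   norm_form q * d1 ^+ 2 - norm_form p * d2 ^+ 2).

Lemma vscale1 p : vscale 1 p = p.
Proof. by case: p => [[a b] d]; rewrite /= !mul1r. Qed.

Lemma on_cubicE a b d :
  on_cubic (a, b, d) -> a ^+ 2 * b = m * d ^+ 3 - a * b ^+ 2.
Proof. by rewrite /on_cubic => <-; ring. Qed.

Lemma on_cubic_opp p : on_cubic p -> on_cubic (vopp p).
Proof. by case: p => [[a b] d] /= <-; ring. Qed.

Lemma on_cubic_scale c p : on_cubic p -> on_cubic (vscale c p).
Proof. by case: p => [[a b] d] /on_cubicE H /=; ring: H. Qed.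

Lemma on_cubic_law i p q : on_cubic p -> on_cubic q -> on_cubic (law i p q).
Proof.
case: p q => [[a1 b1] d1] [[a2 b2] d2] /on_cubicE H1 /on_cubicE H2.
by case: i; rewrite /law /=; ring: H1 H2.
Qed.

Lemma law_par p q : on_cubic p -> on_cubic q -> par (law1 p q) (law2 p q).
Proof.
case: p q => [[a1 b1] d1] [[a2 b2] d2] /on_cubicE H1 /on_cubicE H2.
by rewrite /law /=; split; ring: H1 H2.
Qed.

Lemma law3_par p q : on_cubic p -> on_cubic q -> par (law1 p q) (law3 p q).
Proof.
case: p q => [[a1 b1] d1] [[a2 b2] d2] /on_cubicE H1 /on_cubicE H2.
by rewrite /law /=; split; ring: H1 H2.
Qed.

Lemma law3_par2 p q : on_cubic p -> on_cubic q -> par (law2 p q) (law3 p q).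
Proof.
case: p q => [[a1 b1] d1] [[a2 b2] d2] /on_cubicE H1 /on_cubicE H2.
by rewrite /law /=; split; ring: H1 H2.
Qed.

Lemma lawC p q i :
  law i q p = vscale (-1) (law (~~ i) p q).
Proof.
case: p q => [[a1 b1] d1] [[a2 b2] d2].
by case: i; rewrite /law /=; congr (_, _, _); ring.
Qed.

Lemma law0 p i : law i p (1, -1, 0) = vscale (if i then p.1.1 else p.1.2) p.
Proof. by case: p i => [[a b] d] [] /=; congr (_, _, _); ring. Qed.

Lemma lawN p i : on_cubic p -> par (law i p (vopp p)) (1, -1, 0).
Proof.
case: p => [[a b] d] /on_cubicE H.
by case: i; rewrite /law /=; split; ring: H.
Qed.

Lemma law_scale i c e p q :
  law i (vscale c p) (vscale e q) = vscale (c ^+ 2 * e ^+ 2) (law i p q).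
Proof.
case: p q => [[a1 b1] d1] [[a2 b2] d2].
by case: i; rewrite /law /=; congr (_, _, _); ring.
Qed.

Lemma voppK p : vopp (vopp p) = p.
Proof. by case: p => [[a b] d]. Qed.

Lemma law_neg i p q : law (~~ i) p q = vopp (law i (vopp p) (vopp q)).
Proof. by case: i; rewrite /law /= /law2 ?voppK. Qed.

Lemma law_rev i p q : law i (vopp q) (vopp p) = vscale (-1) (vopp (law i p q)).
Proof. by rewrite lawC law_neg !voppK. Qed.

Definition law_assoc i j k l := forall p q r,
  on_cubic p -> on_cubic q -> on_cubic r ->
  par (law j (law i p q) r) (law l p (law k q r)).

Lemma law_assoc_flip i j k l :
  law_assoc i j k l -> law_assoc (~~ i) (~~ j) (~~ k) (~~ l).
Proof.
move=> H p q r Hp Hq Hr.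
have := H _ _ _ (on_cubic_opp Hp) (on_cubic_opp Hq) (on_cubic_opp Hr).
rewrite !law_neg !voppK.
case: (law j _ _) (law l _ _) => [[a b] d] [[a' b'] d'] /= [E1 E2 E3].
by split; rewrite // mulrC -E1 mulrC.
Qed.

(** Changing all signs and reversing the order of the three points exchanges the
    two ways of bracketing. *)
Lemma law_assoc_swap i j k l : law_assoc i j k l -> law_assoc k l i j.
Proof.
move=> H p q r Hp Hq Hr.
have := H _ _ _ (on_cubic_opp Hr) (on_cubic_opp Hq) (on_cubic_opp Hp).
rewrite !law_rev -[vopp r](vscale1 (vopp r)) -[vopp p](vscale1 (vopp p)).
rewrite !law_scale sqrrN !expr1n mulr1 !vscale1 !law_rev.
case: (law j p _) (law l _ r) => [[a b] d] [[a' b'] d'] /=.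
rewrite !mulN1r !mulrNN => -[E1 E2 E3].
by split; rewrite // mulrC E1 mulrC.
Qed.

(** Associativity holds for every choice of the columns used in the four
    additions, as a polynomial identity modulo the three curve equations. Since
    some choice is nonzero for any three points, no special position has to be
    discussed. Up to the two symmetries only six of the sixteen choices differ. *)
Lemma lawA i j k l : law_assoc i j k l.
Proof.
have [H1 H2 H3] : [/\ law_assoc true true true true,
    law_assoc true false true false & law_assoc true true true false].
  split=> -[[a1 b1] d1] [[a2 b2] d2] [[a3 b3] d3] /on_cubicE E1 /on_cubicE E2 /on_cubicE E3;
    by rewrite /law /=; split; ring: E1 E2 E3.
have [H4 H5 H6] : [/\ law_assoc true true false true,
    law_assoc true true false false & law_assoc true false false true].
  split=> -[[a1 b1] d1] [[a2 b2] d2] [[a3 b3] d3] /on_cubicE E1 /on_cubicE E2 /on_cubicE E3;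
    by rewrite /law /=; split; ring: E1 E2 E3.
have S := law_assoc_swap; have F := law_assoc_flip.
case: i j k l => [] [] [] [] //;
  do ?[exact: F H1 | exact: F H2 | exact: S H3 | exact: F H3 | exact: S (F _ _ _ _ H3)
     | exact: S H4 | exact: F H4 | exact: S (F _ _ _ _ H4) | exact: S H5 | exact: S H6].
Qed.

(** Changing the sign of q exchanges p + q and p - q. *)
Lemma law_trans p q :
  [/\ law1 p (vopp q) = ((law1 p q).1.1, (law2 p q).1.1, (law3 p q).1.1),
      law2 p (vopp q) = ((law1 p q).1.2, (law2 p q).1.2, (law3 p q).1.2)
    & law3 p (vopp q) = ((law1 p q).2, (law2 p q).2, (law3 p q).2)].
Proof.
case: p q => [[a1 b1] d1] [[a2 b2] d2].
by split; rewrite /law /=; congr (_, _, _); ring.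
Qed.

(** For a rank-one matrix u v^T the left-hand side is N(u) N(v), where N is
    [norm_form]. No term on the right is negative when N is not; this lack of
    cancellation is the source of a height inequality without error term. *)
Lemma law_norm p q : on_cubic p -> on_cubic q ->
  let: (x11, x21, _) := law1 p q in let: (x12, x22, _) := law2 p q in
  (x11 ^+ 2 + x11 * x21 + x21 ^+ 2) + (x12 ^+ 2 + x12 * x22 + x22 ^+ 2)
  + (x11 * x12 + x11 * x22 + x21 * x22) =
  (norm_form p * norm_form q) ^+ 2 + 27 * m ^+ 2 * (p.2 * q.2) ^+ 2
     * (norm_form p * q.2 ^+ 2 + norm_form q * p.2 ^+ 2).
Proof.
case: p q => [[a1 b1] d1] [[a2 b2] d2] /on_cubicE H1 /on_cubicE H2.
by rewrite /=; ring: H1 H2.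
Qed.

(** For a matrix u v^T the left-hand side is N(u) d(v)^2 + N(v) d(u)^2. *)
Lemma law_norm_mixed p q : on_cubic p -> on_cubic q ->
  let: (_, _, x31) := law1 p q in let: (_, _, x32) := law2 p q in
  let: (x13, x23, _) := law3 p q in
  (x31 ^+ 2 + x31 * x32 + x32 ^+ 2) + (x13 ^+ 2 + x13 * x23 + x23 ^+ 2) =
  2 * norm_form p * norm_form q
    * (norm_form p * q.2 ^+ 2 + norm_form q * p.2 ^+ 2)
  - 27 * m ^+ 2 * (p.2 * q.2) ^+ 4.
Proof.
case: p q => [[a1 b1] d1] [[a2 b2] d2] /on_cubicE H1 /on_cubicE H2.
by rewrite /=; ring: H1 H2.
Qed.

End Laws.

(** * The group of rational points of C' *)

Section Par.
Variable F : fieldType.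
Implicit Types p q r : F * F * F.

Lemma par_sym p q : par p q -> par q p.
Proof.
by case: p q => [[a1 b1] d1] [[a2 b2] d2] [H1 H2 H3]; split.
Qed.

Lemma parxx p : par p p.
Proof. by case: p => [[a b] d]. Qed.

Lemma par0 p : par (0, 0, 0) p.
Proof. by case: p => [[a b] d]; split; ring. Qed.

Lemma par_scale c p : par (vscale c p) p.
Proof. by case: p => [[a b] d]; split; ring. Qed.

Lemma parP p q : par p q -> q <> (0, 0, 0) -> exists c, p = vscale c q.
Proof.
case: p q => [[a1 b1] d1] [[a2 b2] d2] [H1 H2 H3] nz.
have [a0|a0] := eqVneq a2 0; last first.
  exists (a1 / a2); rewrite /=; congr (_, _, _).
  - by rewrite divfK.
  - by rewrite mulrAC H1 mulrC mulKf.
  - by rewrite mulrAC H2 mulrC mulKf.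
have [b0|b0] := eqVneq b2 0; last first.
  exists (b1 / b2); rewrite /=; congr (_, _, _).
  - by rewrite mulrAC [b1 * _]mulrC -H1 mulfK.
  - by rewrite divfK.
  - by rewrite mulrAC H3 mulrC mulKf.
have [d0|d0] := eqVneq d2 0; first by case: nz; rewrite a0 b0 d0.
exists (d1 / d2); rewrite /=; congr (_, _, _).
- by rewrite mulrAC [d1 * _]mulrC -H2 mulfK.
- by rewrite mulrAC [d1 * _]mulrC -H3 mulfK.
- by rewrite divfK.
Qed.

Lemma par_scalel c p q : par p q -> par (vscale c p) q.
Proof.
case: p q => [[a1 b1] d1] [[a2 b2] d2] [H1 H2 H3].
by split; rewrite -mulrA ?H1 ?H2 ?H3 mulrCA.
Qed.

Lemma par_scalelK c p q : c != 0 -> par (vscale c p) q -> par p q.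
Proof.
case: p q => [[a1 b1] d1] [[a2 b2] d2] c0 [].
by rewrite -!mulrA ![_ * (c * _)]mulrCA => /(mulfI c0)? /(mulfI c0)? /(mulfI c0)?.
Qed.

Lemma par_trans q p r : q <> (0, 0, 0) -> par p q -> par q r -> par p r.
Proof. by move=> q0 /parP -/(_ q0) [c ->]; apply: par_scalel. Qed.

End Par.

Definition hvec (P : c'point) : rat * rat * rat :=
  match P with
  | C'inf100 => (1, 0, 0) | C'inf010 => (0, 1, 0) | C'inf1m10 => (1, -1, 0)
  | C'aff u v => (u, v, 1)
  end.

Definition of_hvec (p : rat * rat * rat) : c'point :=
  let: (a, b, d) := p in
  if d != 0 then C'aff (a / d) (b / d)
  else if b == 0 then C'inf100 else if a == 0 then C'inf010 else C'inf1m10.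

Lemma hvec_neq0 P : hvec P <> (0, 0, 0).
Proof. by case: P => [|||u v] []. Qed.

Lemma hvec_inj P Q : par (hvec P) (hvec Q) -> P = Q.
Proof.
case: P Q => [|||u v] [|||u' v'] //= [];
  rewrite ?(mul0r, mulr0, mul1r, mulr1) // => E1 E2 E3; try (by exfalso; lra).
by rewrite E2 E3.
Qed.

Definition c'opp (P : c'point) : c'point :=
  match P with
  | C'inf100 => C'inf010 | C'inf010 => C'inf100 | C'inf1m10 => C'inf1m10
  | C'aff u v => C'aff v u
  end.

Lemma hvec_opp P : exists c, hvec (c'opp P) = vscale c (vopp (hvec P)).
Proof.
case: P => [|||u v] /=; [exists 1|exists 1|exists (-1)|exists 1].
all: by rewrite /= ?mulN1r ?opprK ?oppr0 ?mul1r.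
Qed.

Section Group.
Variable m : rat.
Hypothesis m0 : m != 0.

Definition on_c' P := on_cubic m (hvec P).

Lemma hvec_of_hvec p : on_cubic m p -> p <> (0, 0, 0) -> par (hvec (of_hvec p)) p.
Proof.
case: p => [[a b] d] /= H nz.
have [d0|d0] /= := eqVneq d 0; last first.
  by split; field; rewrite ?d0.
move: H nz; rewrite d0 expr0n /= mulr0 => /eqP.
have [->|b0] := eqVneq b 0; first by move=> _ _; split; ring.
have [->|a0] := eqVneq a 0; first by move=> _ _; split; ring.
rewrite !mulf_eq0 (negPf a0) (negPf b0) /= addr_eq0 => /eqP -> _.
by split; ring.
Qed.

Lemma on_of_hvec p : on_cubic m p -> p <> (0, 0, 0) -> on_c' (of_hvec p).
Proof.
move=> Hp nz; have := hvec_of_hvec Hp nz => /parP -/(_ nz) [c].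
by rewrite /on_c' => ->; apply: on_cubic_scale.
Qed.

Lemma norm_form_gt0 p : on_cubic m p -> p <> (0, 0, 0) -> 0 < norm_form p.
Proof.
case: p => [[a b] d] /= H nz.
have E : a ^+ 2 + a * b + b ^+ 2 = (a + b / 2) ^+ 2 + 3 * (b / 2) ^+ 2.
  by field.
have A0 := sqr_ge0 (a + b / 2); have B0 := sqr_ge0 (b / 2).
rewrite lt_neqAle; apply/andP; split; last by rewrite E; lra.
apply/eqP => N0; apply: nz.
have /eqP : (b / 2) ^+ 2 = 0 by lra.
have /eqP : (a + b / 2) ^+ 2 = 0 by lra.
rewrite !expf_eq0 /= => /eqP A1 /eqP B1.
have b0 : b = 0 by lra.
have a0 : a = 0 by lra.
move: H; rewrite a0 b0 !mul0r => /esym/eqP.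
by rewrite mulf_eq0 (negPf m0) expf_eq0 /= => /eqP ->.
Qed.

(** If the first two columns vanished, the positive right-hand side of
    [law_norm] would be 0. *)
Lemma law_neq0 p q : on_cubic m p -> on_cubic m q ->
    p <> (0, 0, 0) -> q <> (0, 0, 0) ->
  exists i, law m i p q <> (0, 0, 0).
Proof.
move=> Hp Hq p0 q0.
have [E1|/eqP] := eqVneq (law1 m p q) (0, 0, 0); last by exists true.
have [E2|/eqP] := eqVneq (law2 m p q) (0, 0, 0); last by exists false.
have := law_norm Hp Hq; rewrite E1 E2 !expr0n /= !mul0r !addr0.
have Np := norm_form_gt0 Hp p0; have Nq := norm_form_gt0 Hq q0.
have A0 : 0 < (norm_form p * norm_form q) ^+ 2 by rewrite exprn_gt0 ?mulr_gt0.
have B0 : 0 <= norm_form p * q.2 ^+ 2 + norm_form q * p.2 ^+ 2.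
  by apply: addr_ge0; apply: mulr_ge0; rewrite ?sqr_ge0 ?ltW.
have C0 : 0 <= 27 * m ^+ 2 * (p.2 * q.2) ^+ 2.
  by apply: mulr_ge0 (sqr_ge0 _); apply: mulr_ge0 (sqr_ge0 _); apply: ler0n.
have := mulr_ge0 C0 B0.
move: (_ ^+ 2) A0 => X X0; move: (_ * _) => Y Y0 E.
by have := ltr_pwDl X0 Y0; rewrite -E ltxx.
Qed.

Definition c'add P Q :=
  of_hvec (if law1 m (hvec P) (hvec Q) == (0, 0, 0) then law2 m (hvec P) (hvec Q)
         else law1 m (hvec P) (hvec Q)).

(** Both columns compute the sum, whichever of them defined it. *)
Lemma c'addP P Q : on_c' P -> on_c' Q ->
  on_c' (c'add P Q) /\
  forall i, par (law m i (hvec P) (hvec Q)) (hvec (c'add P Q)).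
Proof.
move=> HP HQ; have HPQ i := on_cubic_law i HP HQ.
have [i] := law_neq0 HP HQ (@hvec_neq0 P) (@hvec_neq0 Q).
have L12 := law_par HP HQ.
rewrite /c'add; have [E1|/eqP E1] := eqVneq.
  case: i; rewrite ?E1 //= => nz; split; first exact: on_of_hvec (HPQ false) nz.
  case=> /=; last exact/par_sym/(hvec_of_hvec (HPQ false)).
  by rewrite E1; apply: par0.
move=> _; split; first exact: on_of_hvec (HPQ true) E1.
case; first exact/par_sym/(hvec_of_hvec (HPQ true)).
exact: par_trans E1 (par_sym L12) (par_sym (hvec_of_hvec (HPQ true) E1)).
Qed.

Lemma on_add P Q : on_c' P -> on_c' Q -> on_c' (c'add P Q).
Proof. by move=> HP HQ; case: (c'addP HP HQ). Qed.

Lemma law_hvec i P Q p q : on_c' P -> on_c' Q -> par p (hvec P) -> par q (hvec Q) ->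
  par (law m i p q) (hvec (c'add P Q)).
Proof.
move=> HP HQ /parP -/(_ (@hvec_neq0 _)) [c ->] /parP -/(_ (@hvec_neq0 _)) [e ->].
by rewrite law_scale; apply: par_scalel; case: (c'addP HP HQ).
Qed.

Lemma c'add_uniq P Q S : on_c' P -> on_c' Q ->
  (forall i, par (law m i (hvec P) (hvec Q)) (hvec S)) -> c'add P Q = S.
Proof.
move=> HP HQ HS; apply: hvec_inj.
have [i nz] := law_neq0 HP HQ (@hvec_neq0 P) (@hvec_neq0 Q).
apply: par_trans nz _ (HS i); apply: par_sym.
by case: (c'addP HP HQ).
Qed.

Lemma c'add0 P : on_c' P -> c'add P C'inf1m10 = P.
Proof.
move=> HP; apply: c'add_uniq => // [|i]; first by rewrite /on_c' /=; ring.
by rewrite law0; apply: par_scale.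
Qed.

Lemma c'addC P Q : on_c' P -> on_c' Q -> c'add P Q = c'add Q P.
Proof.
move=> HP HQ; apply: c'add_uniq => // i; rewrite lawC; apply: par_scalel.
by case: (c'addP HQ HP).
Qed.

Lemma on_opp P : on_c' P -> on_c' (c'opp P).
Proof.
rewrite /on_c' => HP.
have [c ->] := hvec_opp P.
exact/on_cubic_scale/on_cubic_opp.
Qed.

Lemma c'addN P : on_c' P -> c'add P (c'opp P) = C'inf1m10.
Proof.
move=> HP; apply: c'add_uniq => // [|i]; first exact: on_opp.
have [c ->] := hvec_opp P.
rewrite -{1}(vscale1 (hvec P)).
by rewrite law_scale; apply/par_scalel/lawN.
Qed.

Lemma c'addA P Q S : on_c' P -> on_c' Q -> on_c' S ->
  c'add P (c'add Q S) = c'add (c'add P Q) S.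
Proof.
move=> HP HQ HS; have HPQ := on_add HP HQ; have HQS := on_add HQ HS.
apply: hvec_inj.
have [i nzi] := law_neq0 HP HQ (@hvec_neq0 P) (@hvec_neq0 Q).
have [k nzk] := law_neq0 HQ HS (@hvec_neq0 Q) (@hvec_neq0 S).
have [_ /(_ i) Li] := c'addP HP HQ; have [_ /(_ k) Lk] := c'addP HQ HS.
have [j nzj] := law_neq0 (on_cubic_law i HP HQ) HS nzi (@hvec_neq0 S).
have [l nzl] := law_neq0 HP (on_cubic_law k HQ HS) (@hvec_neq0 P) nzk.
have R1 := law_hvec l HP HQS (parxx _) Lk.
have R2 := law_hvec j HPQ HS Li (parxx _).
apply: (par_trans nzl (par_sym R1)).
apply: (par_trans nzj _ R2).
exact/par_sym/lawA.
Qed.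

Definition c'muln n P := iter n (c'add P) C'inf1m10.

Lemma on_O : on_c' C'inf1m10. Proof. by rewrite /on_c' /=; ring. Qed.

Lemma on_muln n P : on_c' P -> on_c' (c'muln n P).
Proof. by move=> HP; elim: n => [|n IH]; [exact: on_O|exact: on_add]. Qed.

Lemma c'mulnD n k P : on_c' P ->
  c'muln (n + k) P = c'add (c'muln n P) (c'muln k P).
Proof.
move=> HP; elim: n => [|n IH].
  by rewrite add0n /= (c'addC on_O (on_muln k HP)) c'add0 //; apply: on_muln.
by rewrite addSn /= IH c'addA //; apply: on_muln.
Qed.

Lemma c'mulnM n k P : on_c' P -> c'muln (n * k) P = c'muln n (c'muln k P).
Proof.
move=> HP; elim: n => [|n IH] //.
by rewrite mulSn c'mulnD // IH.
Qed.

End Group.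

(** * The isogeny tau is additive *)

Section Fermat.
Variables (R : comNzRingType) (m : R).
Local Notation vec := (R * R * R)%type.
Implicit Types p q r : vec.

Definition on_fermat p := let: (x, y, z) := p in x ^+ 3 + y ^+ 3 = m * z ^+ 3.

(** Two addition laws on X^3 + Y^3 = m Z^3. At affine rational points
    [chord_law] degenerates only on the diagonal, and [tangent_law] does not
    degenerate there. *)
Definition chord_law p q : vec :=
  let: (x1, y1, z1) := p in let: (x2, y2, z2) := q in
  (y1 ^+ 2 * x2 * z2 - y2 ^+ 2 * x1 * z1,
   x1 ^+ 2 * y2 * z2 - x2 ^+ 2 * y1 * z1,
   z1 ^+ 2 * x2 * y2 - z2 ^+ 2 * x1 * y1).

Definition tangent_law p q : vec :=
  let: (x1, y1, z1) := p in let: (x2, y2, z2) := q in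
  (x2 ^+ 2 * x1 * y1 + m * z1 ^+ 2 * z2 * y2,
   - (m * z2 ^+ 2 * z1 * x1 + y1 ^+ 2 * x2 * y2),
   y2 ^+ 2 * y1 * z1 - x1 ^+ 2 * x2 * z2).

Definition tau_vec p : vec :=
  let: (a, b, d) := p in
  (- a ^+ 3 + 3 * a ^+ 2 * b + 6 * a * b ^+ 2 + b ^+ 3,
   a ^+ 3 + 6 * a ^+ 2 * b + 3 * a * b ^+ 2 - b ^+ 3,
   3 * d * norm_form p).

Lemma on_tau p : on_cubic m p -> on_fermat (tau_vec p).
Proof.
by case: p => [[a b] d] /on_cubicE H; rewrite /=; ring: H.
Qed.

Lemma tau_scale c p : tau_vec (vscale c p) = vscale (c ^+ 3) (tau_vec p).
Proof. by case: p => [[a b] d]; congr (_, _, _); rewrite /=; ring. Qed.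

Lemma tau_chord i p q : on_cubic m p -> on_cubic m q ->
  par (tau_vec (law m i p q)) (chord_law (tau_vec p) (tau_vec q)).
Proof.
case: p q => [[a1 b1] d1] [[a2 b2] d2] /on_cubicE H1 /on_cubicE H2.
by case: i; rewrite /law /=; split; ring: H1 H2.
Qed.

Lemma tau_tangent i p q : on_cubic m p -> on_cubic m q ->
  par (tau_vec (law m i p q)) (tangent_law (tau_vec p) (tau_vec q)).
Proof.
case: p q => [[a1 b1] d1] [[a2 b2] d2] /on_cubicE H1 /on_cubicE H2.
by case: i; rewrite /law /=; split; ring: H1 H2.
Qed.

Lemma chord_law_scale c e p q :
  chord_law (vscale c p) (vscale e q) = vscale (c ^+ 2 * e ^+ 2) (chord_law p q).
Proof.
case: p q => [[x1 y1] z1] [[x2 y2] z2].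
by rewrite /=; congr (_, _, _); ring.
Qed.

Lemma tangent_law_scale c e p q :
  tangent_law (vscale c p) (vscale e q) =
  vscale (c ^+ 2 * e ^+ 2) (tangent_law p q).
Proof.
case: p q => [[x1 y1] z1] [[x2 y2] z2].
by rewrite /=; congr (_, _, _); ring.
Qed.

(** The isogeny dual to tau is (x : y : z) |-> (y^3 : x^3 : xyz), and the
    composite of the two is multiplication by 3. *)
Lemma triple_law i p : on_cubic m p ->
  let: (x, y, z) := tau_vec p in
  par (law m i p (law m true p p)) (y ^+ 3, x ^+ 3, x * y * z).
Proof.
case: p => [[a b] d] /on_cubicE H.
by case: i; rewrite /law /=; split; ring: H.
Qed.

End Fermat.

Definition hvecC (P : cpoint) : rat * rat * rat :=
  if P is Caff u v then (u, v, 1) else (1, -1, 0).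

Lemma hvecC_neq0 P : hvecC P <> (0, 0, 0).
Proof. by case: P => [|u v] []. Qed.

Lemma hvecC_inj P Q : par (hvecC P) (hvecC Q) -> P = Q.
Proof.
case: P Q => [|u v] [|u' v'] //= [];
  rewrite ?(mul0r, mulr0, mul1r, mulr1) // => E1 E2 E3; try (by exfalso; lra).
by rewrite E2 E3.
Qed.

Lemma cube_inj : injective (fun x : rat => x ^+ 3).
Proof.
move=> x y /= /eqP; rewrite -subr_eq0.
have -> : x ^+ 3 - y ^+ 3 = (x - y) * ((x + y / 2) ^+ 2 + 3 * (y / 2) ^+ 2).
  by field.
have A0 := sqr_ge0 (x + y / 2); have B0 := sqr_ge0 (y / 2).
rewrite mulf_eq0 subr_eq0 => /orP [/eqP //|/eqP N0].
have /eqP : (y / 2) ^+ 2 = 0 by lra.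
have /eqP : (x + y / 2) ^+ 2 = 0 by lra.
by rewrite !expf_eq0 /= => /eqP A1 /eqP B1; lra.
Qed.

Section Tau.
Variable m : rat.
Hypothesis m0 : m != 0.

(** The vanishing of the three coordinates forces u1^3 = u2^3 and v1^3 = v2^3,
    and cubing is injective on the rationals. *)
Lemma chord_neq0 u1 v1 u2 v2 : on_fermat m (u1, v1, 1) -> on_fermat m (u2, v2, 1) ->
  chord_law (u1, v1, 1) (u2, v2, 1) = (0, 0, 0) -> u1 = u2 /\ v1 = v2.
Proof.
rewrite /= !expr1n !mulr1 !mul1r => H1 H2 [/eqP E1 /eqP E2 /eqP E3].
move: E1 E2 E3; rewrite !subr_eq0 => /eqP E1 /eqP E2 /eqP E3.
have D1 : u1 = u2.
  have [u0|u0] := eqVneq u1 0.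
    have v10 : v1 != 0.
      by apply: contra_neq m0 => v10; rewrite -H1 u0 v10 expr0n addr0.
    move: E1; rewrite u0 mulr0 => /eqP.
    by rewrite mulf_eq0 expf_eq0 (negPf v10) /= => /eqP.
  apply: cube_inj; apply: (mulIf u0); rewrite /=.
  have [w0|w0] := eqVneq v1 0.
    move: E2 E3; rewrite w0 mulr0 mulr0 => /eqP; rewrite mulf_eq0 expf_eq0 (negPf u0) /=.
    by move=> /eqP w20 _; move: H1 H2; rewrite w0 w20 expr0n /= !addr0 => -> ->.
  have u20 : u2 != 0.
    apply: contra_neq w0 => u20; move: E3; rewrite u20 mul0r => /esym/eqP.
    by rewrite mulf_eq0 (negPf u0) => /eqP.
  apply: (mulIf w0).
  transitivity (u1 ^+ 3 * (u2 * v2)); first by rewrite E3; ring.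
  transitivity (u1 * u2 * (u1 ^+ 2 * v2)); first by ring.
  by rewrite E2; ring.
split=> //; apply: cube_inj => /=.
by apply: (addrI (u1 ^+ 3)); rewrite H1 D1 H2.
Qed.

Lemma cadd_chord u1 v1 u2 v2 : on_fermat m (u1, v1, 1) -> on_fermat m (u2, v2, 1) ->
  ~~ ((u1 == u2) && (v1 == v2)) ->
  par (chord_law (u1, v1, 1) (u2, v2, 1)) (hvecC (cadd (Caff u1 v1) (Caff u2 v2))).
Proof.
move=> H1 H2 ne; have := chord_neq0 H1 H2; move: H1 H2.
rewrite /= !expr1n !mulr1 => H1 H2 nz.
have H1' : u1 ^+ 3 = m - v1 ^+ 3 by rewrite -H1; ring.
have H2' : u2 ^+ 3 = m - v2 ^+ 3 by rewrite -H2; ring.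
rewrite /cadd /third_point /third_affine (negPf ne).
have [ab0|ab0] := eqVneq (u2 - u1 + (v2 - v1)) 0.
  have V2 : v2 = u1 + v1 - u2 by lra.
  have s0 : u1 + v1 != 0.
    apply: contra_neq m0 => s0; rewrite -H1.
    have -> : v1 = - u1 by lra.
    by ring.
  have P0 : u1 * v1 - u2 * v2 = 0.
    have : 3 * (u1 + v1) * (u1 * v1 - u2 * v2) = 0.
      have -> : 3 * (u1 + v1) * (u1 * v1 - u2 * v2) =
        (u2 ^+ 3 + v2 ^+ 3) - (u1 ^+ 3 + v1 ^+ 3) by rewrite V2; ring.
      by rewrite H1 H2 subrr.
    move/eqP; rewrite !mulf_eq0 (negPf s0) /= => /eqP //.
  have P0' : v1 * u1 = u2 * v2 by lra.
  split=> /=; rewrite ?mulr1 ?mul1r ?mulr0 ?mul0r.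
  - apply/eqP; rewrite -subr_eq0; apply/eqP.
    by rewrite -[RHS](mulr0 (u1 + v1)) -P0 V2; ring.
  - lra.
  - lra.
rewrite /=.
set a := u2 - u1; set b := v2 - v1.
have c0 : a ^+ 3 + b ^+ 3 != 0.
  apply: contra_neq ab0 => c0; apply/eqP; rewrite addr_eq0; apply/eqP/cube_inj => /=.
  by rewrite exprNn; move: c0; rewrite -/a -/b => c0; lra.
rewrite /a /b in c0 *; split; rewrite ?mulr1 ?mul1r.
- by field: H1' H2'.
- by field: H1' H2'.
- by field: H1' H2'.
Qed.

Lemma cadd_tangent u v : on_fermat m (u, v, 1) ->
  par (tangent_law m (u, v, 1) (u, v, 1)) (hvecC (cadd (Caff u v) (Caff u v))) /\
  tangent_law m (u, v, 1) (u, v, 1) <> (0, 0, 0).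
Proof.
rewrite /= !expr1n !mulr1 => H.
have H' : u ^+ 3 = m - v ^+ 3 by rewrite -H; ring.
split; last first.
  rewrite /= => -[E1 _ E3].
  have vu : v = u.
    by apply: cube_inj; apply/eqP; rewrite -subr_eq0 -E3 /=; apply/eqP; ring.
  have /eqP : 3 * u ^+ 4 = 0 by rewrite -[RHS]E1 -H vu; ring.
  rewrite mulf_eq0 expf_eq0 /= => /eqP u0.
  by move/eqP: m0; apply; rewrite -H vu u0; ring.
rewrite /cadd /third_point /third_affine !eqxx /=.
have [ab0|ab0] := eqVneq (v ^+ 2 + - u ^+ 2) 0.
  have uv : u = v.
    have : (v - u) * (v + u) = 0 by rewrite -ab0; ring.
    move/eqP; rewrite mulf_eq0 => /orP [|] /eqP E; first by lra.
    exfalso; move/eqP: m0; apply; rewrite -H.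
    have -> : v = - u by lra.
    by ring.
  by rewrite uv; split; ring.
rewrite /=.
have c0 : (v ^+ 2) ^+ 3 + (- u ^+ 2) ^+ 3 != 0.
  apply: contra_neq ab0 => c0; apply/eqP; rewrite addr_eq0; apply/eqP/cube_inj => /=.
  by rewrite exprNn; move: c0 => c0; lra.
split; rewrite ?mulr1 ?mul1r ?expr1n.
- by field: H'.
- by field: H'.
- by field: H'.
Qed.

Lemma hvec_tau P : on_c' m P -> par (hvecC (tau P)) (tau_vec (hvec P)).
Proof.
case: P => [|||u v] H.
- by split; rewrite /=; ring.
- by split; rewrite /=; ring.
- by split; rewrite /=; ring.
have := norm_form_gt0 m0 H (@hvec_neq0 (C'aff u v)).
move/lt0r_neq0; rewrite /= => n0.
by split; field; rewrite n0.
Qed.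

Lemma tau_vec_neq0 P : on_c' m P -> tau_vec (hvec P) <> (0, 0, 0).
Proof.
case: P => [|||u v] H; try by move/eqP.
rewrite /= => -[_ _ /eqP].
have := norm_form_gt0 m0 H (@hvec_neq0 (C'aff u v)).
by move/lt0r_neq0; rewrite /= => n0; rewrite mulr1 mulf_eq0 (negPf n0).
Qed.

Lemma tau_on_C P : on_c' m P -> on_fermat m (hvecC (tau P)).
Proof.
move=> HP; have := hvec_tau HP => /parP -/(_ (tau_vec_neq0 HP)) [c ->].
move: (on_tau HP); case: (tau_vec (hvec P)) => [[x y] z] /= H.
transitivity (c ^+ 3 * (x ^+ 3 + y ^+ 3)); first by ring.
by rewrite H; ring.
Qed.

Lemma law_tau_hvec i P Q p : on_c' m P -> on_c' m Q -> 
  par p (tau_vec (law m i (hvec P) (hvec Q))) -> 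
  law m i (hvec P) (hvec Q) <> (0, 0, 0) ->
  par p (tau_vec (hvec (c'add m P Q))).
Proof.
move=> HP HQ Hp nz; have [HPQ /(_ i)] := c'addP m0 HP HQ.
move/parP => /(_ (@hvec_neq0 _)) [c E].
have c0 : c != 0.
  by apply: contra_not_neq nz => c0; rewrite E c0; case: (hvec _) => [[a b] d] /=; rewrite !mul0r.
move: Hp; rewrite E tau_scale => /par_sym Hp; apply: par_sym.
by apply: par_scalelK Hp; apply: expf_neq0.
Qed.

(** Every column of the addition matrix is mapped by [tau_vec] to a multiple
    of both laws on C; the chord law decides at distinct images, the tangent law
    at equal ones. *)
Lemma tau_add P Q : on_c' m P -> on_c' m Q -> tau P <> Cinf -> tau Q <> Cinf ->
  cadd (tau P) (tau Q) = tau (c'add m P Q).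
Proof.
move=> HP HQ tP tQ.
have HPQ := on_add m0 HP HQ.
have [i nz] := law_neq0 m0 HP HQ (@hvec_neq0 P) (@hvec_neq0 Q).
apply: hvecC_inj; apply: par_trans (tau_vec_neq0 HPQ) _ (par_sym (hvec_tau HPQ)).
apply: law_tau_hvec nz => //.
have [c EP] := parP (par_sym (hvec_tau HP)) (@hvecC_neq0 _).
have [e EQ] := parP (par_sym (hvec_tau HQ)) (@hvecC_neq0 _).
have Lc := tau_chord i HP HQ; have Lt := tau_tangent i HP HQ.
have := tau_on_C HP; have := tau_on_C HQ.
move: EP EQ tP tQ; case: (tau P) => [|u1 v1] //; case: (tau Q) => [|u2 v2] // EP EQ _ _.
move=> CQ CP.
have scale_neq0 k p : vscale k p <> (0, 0, 0) :> rat * rat * rat -> k != 0.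
  by apply: contra_not_neq => ->; case: p => [[a b] d]; rewrite /= !mul0r.
have c0 : c != 0 by apply: (@scale_neq0 _ (u1, v1, 1)); rewrite -EP; apply: tau_vec_neq0.
have e0 : e != 0 by apply: (@scale_neq0 _ (u2, v2, 1)); rewrite -EQ; apply: tau_vec_neq0.
have ce0 : c ^+ 2 * e ^+ 2 != 0 by rewrite mulf_neq0 ?expf_neq0.
have [/andP [/eqP E1 /eqP E2]|ne] := boolP ((u1 == u2) && (v1 == v2)).
  have [T1 T2] := cadd_tangent CP.
  move: Lt; rewrite EP EQ -E1 -E2 tangent_law_scale => /par_sym Lt.
  by apply: par_trans T2 (par_sym T1) (par_scalelK ce0 Lt).
move: Lc; rewrite EP EQ chord_law_scale => /par_sym Lc.
apply: par_trans _ (par_sym (cadd_chord CP CQ ne)) (par_scalelK ce0 Lc).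
by move=> /(chord_neq0 CP CQ) [E1 E2]; move: ne; rewrite E1 E2 !eqxx.
Qed.

Lemma cmuln_tau P n : on_c' m P -> nontorsion (tau P) ->
  cmuln n (tau P) = tau (c'muln m n P).
Proof.
move=> HP nt; elim: n => [//|n IH].
case: n IH => [|n] IH.
  by rewrite /= (c'add0 m0 HP) /cadd /=; case: (tau P).
have N1 := nt 1%N isT; have Nn := nt n.+1 isT.
rewrite /cmuln iterS -/(cmuln _ _) IH /c'muln iterS -/(c'muln _ _ _).
apply: (tau_add HP (on_muln m0 n.+1 HP)).
- by move=> E; apply: N1; rewrite /cmuln /= E.
- by rewrite -IH.
Qed.

End Tau.

(** * Primitive integer coordinates *)

Lemma Euclid_dvdzM (p : nat) (a b : int) : prime p ->
  (p %| a * b)%Z = (p %| a)%Z || (p %| b)%Z.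
Proof. by move=> pp; rewrite !dvdzE abszM Euclid_dvdM. Qed.

Lemma Euclid_dvdzX (p : nat) (a : int) n : prime p ->
  (p %| a ^+ n)%Z = (p %| a)%Z && (0 < n)%N.
Proof. by move=> pp; rewrite !dvdzE abszX Euclid_dvdX. Qed.

Lemma coprimez_prime (a b : int) :
  (forall p : nat, prime p -> (p %| a)%Z -> (p %| b)%Z -> False) ->
  coprimez a b.
Proof.
move=> H; rewrite coprimezE; apply/negPn/negP => ne1.
have := pdiv_dvd (gcdn `|a| `|b|); rewrite dvdn_gcd => /andP [pa pb].
have [g0|g0] := posnP (gcdn `|a| `|b|).
  apply: (H 2%N) => //; rewrite dvdzE.
    by move: (dvdn_gcdl `|a| `|b|); rewrite g0 dvd0n => /eqP ->.
  by move: (dvdn_gcdr `|a| `|b|); rewrite g0 dvd0n => /eqP ->.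
apply: (H (pdiv (gcdn `|a| `|b|))); rewrite ?dvdzE //.
by apply: pdiv_prime; rewrite ltn_neqAle eq_sym g0 andbT; apply: ne1.
Qed.

Lemma prime_coprimez (p : nat) (a b : int) : prime p -> coprimez a b ->
  (p %| a)%Z -> (p %| b)%Z -> False.
Proof.
move=> pp; rewrite coprimezE => co pa pb.
have : (p %| gcdn `|a| `|b|)%N by rewrite dvdn_gcd; apply/andP.
by rewrite (eqP co) dvdn1 => /eqP E; rewrite E in pp.
Qed.

Lemma par_bezout (R : comNzRingType) (u v : R) (p z : R * R * R) :
  u * z.1.1 + v * z.1.2 = 1 -> par p z -> exists c, p = vscale c z.
Proof.
case: p z => [[a1 b1] d1] [[a2 b2] d2] /= E [H1 H2 H3].
exists (u * a1 + v * b1); congr (_, _, _).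
- by rewrite -[LHS]mul1r -E; ring: H1.
- by rewrite -[LHS]mul1r -E; ring: H1.
- have -> : d1 = u * (a2 * d1) + v * (b2 * d1) by rewrite -[LHS]mul1r -E; ring.
  by rewrite -H2 -H3; ring.
Qed.

Definition ratv (x : int * int * int) : rat * rat * rat :=
  let: (a, b, d) := x in (a%:~R, b%:~R, d%:~R).

Lemma par_ratv x y : par (ratv x) (ratv y) <-> par x y.
Proof.
case: x y => [[a1 b1] d1] [[a2 b2] d2]; rewrite /= -!rmorphM /=.
split=> -[H1 H2 H3]; last by rewrite H1 H2 H3.
by split; [apply: intr_inj H1 | apply: intr_inj H2 | apply: intr_inj H3].
Qed.

Lemma on_cubic_ratv m x : on_cubic m%:~R (ratv x) <-> on_cubic m x.
Proof.
case: x => [[a b] d]; rewrite /= -rmorphXn -rmorphD -!rmorphM /=.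
by split=> [/intr_inj|->].
Qed.

Lemma law_ratv m i x y :
  ratv (law m i x y) = law m%:~R i (ratv x) (ratv y).
Proof.
case: x y => [[a1 b1] d1] [[a2 b2] d2].
by case: i; rewrite /law /=; congr (_, _, _); ring.
Qed.

Lemma law3_ratv x y :
  ratv (law3 x y) = law3 (ratv x) (ratv y).
Proof.
case: x y => [[a1 b1] d1] [[a2 b2] d2].
by rewrite /=; congr (_, _, _); ring.
Qed.

Section Primitive.
Variable m : int.
Hypothesis m0 : m <> 0.
Hypothesis cfm : cube_free m.

(** Coprimality of the first two coordinates alone is stronger than
    gcd(a, b, d) = 1; it can be demanded because m is cube-free. *)
Definition prim x P :=
  [/\ on_cubic m x, coprimez x.1.1 x.1.2 & par (ratv x) (hvec P)].

Lemma intr_mQ_neq0 : m%:~R != 0 :> rat.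
Proof. by rewrite intr_eq0; apply/eqP. Qed.

Local Notation onC := (on_c' m%:~R).

Lemma prim_neq0 x P : prim x P -> ratv x <> (0, 0, 0).
Proof.
case: x => [[a b] d] [_ /= co _] [/eqP a0 /eqP b0 _].
by move: a0 b0 co; rewrite !intr_eq0 => /eqP -> /eqP ->.
Qed.

Lemma prim_on x P : prim x P -> onC P.
Proof.
move=> pP; have nz := prim_neq0 pP; case: pP => Hx _ /par_sym /parP -/(_ nz) [c E].
by rewrite /on_c' E; apply/on_cubic_scale/on_cubic_ratv.
Qed.

(** A prime dividing both a and b does not divide d, so its cube divides m. *)
Lemma prim_exists P : onC P -> exists x, prim x P.
Proof.
case: P => [|||u v] HP.
- by exists (1, 0, 0); split => //=; rewrite expr0n /= !mulr0.
- by exists (0, 1, 0); split => //=; rewrite expr0n /= !mulr0 !mul0r.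
- by exists (1, -1, 0); split => //=; rewrite expr0n /= !mulr0.
pose A := numq u * denq v; pose B := numq v * denq u; pose D := denq u * denq v.
pose g := gcdz (gcdz A B) D.
have D0 : D != 0 by rewrite mulf_neq0 ?denq_neq0.
have g0 : g != 0 by rewrite gcdz_eq0 negb_and D0 orbT.
have gA : (g %| A)%Z by apply: dvdz_trans (dvdz_gcdl _ _) (dvdz_gcdl _ _).
have gB : (g %| B)%Z by apply: dvdz_trans (dvdz_gcdl _ _) (dvdz_gcdr _ _).
have gD : (g %| D)%Z by apply: dvdz_gcdr.
have [a Ea] := dvdzP gA; have [b Eb] := dvdzP gB; have [d Ed] := dvdzP gD.
have gQ : g%:~R != 0 :> rat by rewrite intr_eq0.
have Eu : u * (denq u)%:~R = (numq u)%:~R.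
  by rewrite -{1}[u]divq_num_den divfK // intr_eq0 denq_neq0.
have Ev : v * (denq v)%:~R = (numq v)%:~R.
  by rewrite -{1}[v]divq_num_den divfK // intr_eq0 denq_neq0.
have au : a%:~R = u * d%:~R.
  apply: (mulIf gQ); rewrite -mulrA -!intrM -Ea -Ed /A /D !intrM -Eu.
  by rewrite mulrA.
have bv : b%:~R = v * d%:~R.
  apply: (mulIf gQ); rewrite -mulrA -!intrM -Eb -Ed /B /D !intrM -Ev.
  by rewrite mulrCA mulrC mulrA.
have Hx : on_cubic m (a, b, d).
  apply/on_cubic_ratv; rewrite /= au bv; move: HP; rewrite /on_c' /= expr1n mulr1 => <-.
  by ring.
exists (a, b, d); split => //=; last by rewrite au bv; split; ring.
apply: coprimez_prime => p pp pa pb.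
have pd : ~~ (p %| d)%Z.
  apply/negP => pd; have : (p%:Z * g %| gcdz (gcdz A B) D)%Z.
    by rewrite !dvdz_gcd Ea Eb Ed !dvdz_mul2r // pa pb pd.
  rewrite -/g.
  by rewrite -[X in (_ %| X)%Z]mul1r dvdz_mul2r // dvdz1 => /eqP E; move: pp; rewrite -[p]/(`|p|%N) E.
apply: (cfm pp).
have p3d : coprimez (p ^ 3)%N (d ^+ 3).
  by rewrite coprimezE abszX /= coprimeXl // coprimeXr // prime_coprime.
rewrite -(Gauss_dvdzl _ p3d) -Hx.
have [a' ->] := dvdzP pa; have [b' ->] := dvdzP pb.
apply/dvdzP; exists (a' * b' * (a' + b')).
by rewrite !expnS expn0 muln1 !PoszM; ring.
Qed.

Lemma prim_opp x P : prim x P -> prim (vopp x) (c'opp P).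
Proof.
case: x => [[a b] d] [H1 H2 H3]; split.
- exact: on_cubic_opp.
- by rewrite coprimez_sym.
have [c ->] := hvec_opp P; apply/par_sym/par_scalel.
move: H3; case: (hvec P) => [[u v] w] [E1 E2 E3].
by split; rewrite // mulrC E1 mulrC.
Qed.

Lemma law_prim i x y z P Q : prim x P -> prim y Q -> prim z (c'add m%:~R P Q) ->
  par (law m i x y) z.
Proof.
move=> Px Py Pz; have [_ _ X3] := Px; have [_ _ Y3] := Py; have [_ _ Z3] := Pz.
apply/par_ratv; rewrite law_ratv.
have := law_hvec intr_mQ_neq0 i (prim_on Px) (prim_on Py) X3 Y3.
by move/par_trans; apply; [exact: hvec_neq0 | exact: par_sym].
Qed.

Lemma law3_prim x y z P Q : prim x P -> prim y Q -> prim z (c'add m%:~R P Q) ->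
  par (law3 x y) z.
Proof.
move=> Px Py Pz; have [X1 _ _] := Px; have [Y1 _ _] := Py.
have X1' := (on_cubic_ratv m x).2 X1; have Y1' := (on_cubic_ratv m y).2 Y1.
have [i nz] := law_neq0 intr_mQ_neq0 X1' Y1' (prim_neq0 Px) (prim_neq0 Py).
apply/par_ratv; rewrite law3_ratv.
have Lz : par (law m%:~R i (ratv x) (ratv y)) (ratv z).
  by rewrite -law_ratv; apply/par_ratv; apply: law_prim Px Py Pz.
case: i nz Lz => nz Lz; apply: par_trans nz _ Lz; apply: par_sym.
  exact: law3_par X1' Y1'.
exact: law3_par2 X1' Y1'.
Qed.

Lemma par_coprime (p z : int * int * int) : coprimez z.1.1 z.1.2 -> par p z ->
  exists c, p = vscale c z.
Proof. by move=> /coprimezP [[u v] /= E]; apply: par_bezout E. Qed.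

(** For primitive coordinates z of P + Q and w of P - Q, the addition matrix is
    an integral multiple of z w^T; the factor g is its content. *)
Lemma law_factor x y z w P Q : prim x P -> prim y Q ->
  prim z (c'add m%:~R P Q) -> prim w (c'add m%:~R P (c'opp Q)) ->
  exists g, [/\ law1 m x y = vscale (g * w.1.1) z,
    law2 m x y = vscale (g * w.1.2) z & law3 x y = vscale (g * w.2) z].
Proof.
move=> Px Py Pz Pw; have Pny := prim_opp Py.
have [_ coz _] := Pz; have [_ cow _] := Pw.
have [c1 E1] := par_coprime coz (law_prim true Px Py Pz).
have [c2 E2] := par_coprime coz (law_prim false Px Py Pz).
have [c3 E3] := par_coprime coz (law3_prim Px Py Pz).
have [T1 T2 _] := law_trans m x y.
have L1 := law_prim true Px Pny Pw; have L2 := law_prim false Px Pny Pw.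
move: E1 E2 E3 T1 T2 L1 L2; rewrite /law /= => -> -> -> -> ->.
case: z Pz coz => [[a b] d] _ /= coz.
have /coprimezP [[u v] /= Ez] := coz.
case: w Pw cow => [[a' b'] d'] _ cow /= [H1 H2 H3] [H4 H5 H6].
have : par (c1, c2, c3) (a', b', d').
  split.
  - rewrite -[LHS]mul1r -[RHS]mul1r -Ez.
    have -> : (u * a + v * b) * (c1 * b') = u * (c1 * a * b') + v * (c1 * b * b') by ring.
    by rewrite H1 H4; ring.
  - rewrite -[LHS]mul1r -[RHS]mul1r -Ez.
    have -> : (u * a + v * b) * (c1 * d') = u * (c1 * a * d') + v * (c1 * b * d') by ring.
    by rewrite H2 H5; ring.
  - rewrite -[LHS]mul1r -[RHS]mul1r -Ez.
    have -> : (u * a + v * b) * (c2 * d') = u * (c2 * a * d') + v * (c2 * b * d') by ring.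
    by rewrite H3 H6; ring.
by move=> /(par_coprime cow) [g [-> -> ->]]; exists g.
Qed.

End Primitive.

(** * The form a^2 + ab + b^2 at a primitive point *)

Lemma dvdz_comb (p u v s t : int) :
  (p %| u)%Z -> (p %| v)%Z -> (p %| s * u + t * v)%Z.
Proof. by move=> pu pv; rewrite rpredD // dvdz_mull. Qed.

Lemma norm_formE (a b d : int) : norm_form (a, b, d) = a ^+ 2 + a * b + b ^+ 2.
Proof. by []. Qed.

(** Modulo p, each of a = 0, b = 0 and a + b = 0 turns a^2 + ab + b^2 = 0 into
    a = b = 0. *)
Lemma norm_prime (p : nat) (x : int * int * int) :
    prime p -> coprimez x.1.1 x.1.2 -> (p %| norm_form x)%Z ->
  ~~ (p %| x.1.1 * x.1.2 * (x.1.1 + x.1.2))%Z.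
Proof.
case: x => [[a b] d] pp co; rewrite norm_formE /= => pN; rewrite !Euclid_dvdzM //.
have bad : (p %| a)%Z -> (p %| b)%Z -> False by apply: prime_coprimez.
apply/negP => /orP [/orP [pa|pb]|pab].
- apply: bad => //; have : (p %| b ^+ 2)%Z.
    have -> : b ^+ 2 = 1 * (a ^+ 2 + a * b + b ^+ 2) + - (a + b) * a by ring.
    exact: dvdz_comb.
  by rewrite Euclid_dvdzX // andbT.
- apply: bad => //; have : (p %| a ^+ 2)%Z.
    have -> : a ^+ 2 = 1 * (a ^+ 2 + a * b + b ^+ 2) + - (a + b) * b by ring.
    exact: dvdz_comb.
  by rewrite Euclid_dvdzX // andbT.
- have pa : (p %| a)%Z.
    have : (p %| a ^+ 2)%Z.
      have -> : a ^+ 2 = 1 * (a ^+ 2 + a * b + b ^+ 2) + - b * (a + b) by ring.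
      exact: dvdz_comb.
    by rewrite Euclid_dvdzX // andbT.
  apply: bad => //; have -> : b = 1 * (a + b) + (-1) * a by ring.
  exact: dvdz_comb.
Qed.

Section Norm.
Variable m : int.

Definition primitive x := on_cubic m x /\ coprimez x.1.1 x.1.2.

Lemma norm_prime_m (p : nat) x : prime p -> primitive x -> (p %| norm_form x)%Z ->
  ~~ (p %| m)%Z /\ ~~ (p %| x.2)%Z.
Proof.
move=> pp [Hx co] pN; have := norm_prime pp co pN.
case: x Hx {co pN} => [[a b] d] /= ->.
by rewrite Euclid_dvdzM // Euclid_dvdzX // andbT negb_or => /andP.
Qed.

Lemma norm_ge1 x : primitive x -> 1 <= norm_form x.
Proof.
case: x => [[a b] d] [_ /= co].
have [a0|a0] := eqVneq a 0; last by nia.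
have [b0|b0] := eqVneq b 0; last by nia.
by rewrite a0 b0 in co.
Qed.

(** This is the discriminant of the cubic polynomial with roots a, b, -(a + b).
    It bounds m d^3 by a multiple of N^(3/2). *)
Lemma norm_disc (a b d : int) : on_cubic m (a, b, d) ->
  4 * norm_form (a, b, d) ^+ 3 = 27 * m ^+ 2 * d ^+ 6
    + ((a - b) * (2 * a + b) * (a + 2 * b)) ^+ 2.
Proof.
move=> H; have {}H : a * b * (a + b) = m * d ^+ 3 by [].
rewrite norm_formE; have -> : 27 * m ^+ 2 * d ^+ 6 = 27 * (m * d ^+ 3) ^+ 2 by ring.
by rewrite -H; ring.
Qed.

Lemma norm_dvd3_congr (a b d : int) : coprimez a b -> (3 %| norm_form (a, b, d))%Z ->
  exists k, a = b + 3 * k /\ ~~ (3 %| b)%Z.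
Proof.
move=> co; rewrite norm_formE => H3.
have : (3 %| a - b)%Z.
  have : (3%N %| (a - b) ^+ 2)%Z.
    have -> : (a - b) ^+ 2 = 1 * (a ^+ 2 + a * b + b ^+ 2) + (- (a * b)) * 3 by ring.
    exact: dvdz_comb.
  by rewrite Euclid_dvdzX // andbT.
move=> /dvdzP [k Ek]; exists k; have Ea : a = b + 3 * k by lia.
split=> //; apply/negP => b3.
apply: (@prime_coprimez 3 a b) => //.
rewrite Ea; have -> : b + 3 * k = 1 * b + k * 3 by ring.
exact: dvdz_comb.
Qed.

Lemma sqr_mod3 (t : int) : ~~ (3 %| t)%Z -> exists s, t ^+ 2 = 1 + 3 * s.
Proof.
move=> t3; have [[q E]|[q E]] : (exists q, t = 3 * q + 1) \/ (exists q, t = 3 * q + 2).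
  have E := divz_eq t 3; have L := ltz_mod t (isT : 3 != 0 :> int).
  have G := modz_ge0 t (isT : 3 != 0 :> int).
  have ne : (t %% 3)%Z != 0 by apply: contraNneq t3 => /dvdz_mod0P.
  have [e|e] : (t %% 3)%Z = 1 \/ (t %% 3)%Z = 2 by lia.
    by left; exists (t %/ 3)%Z; lia.
  by right; exists (t %/ 3)%Z; lia.
by exists (3 * q ^+ 2 + 2 * q); rewrite E; ring.
by exists (3 * q ^+ 2 + 4 * q + 1); rewrite E; ring.
Qed.

(** N = (a - b)^2 + 3ab, so 3 divides N only if a = b + 3k, and then
    N/3 = b^2 + 3bk + 3k^2. *)
Lemma norm_dvd3_third x : coprimez x.1.1 x.1.2 -> (3 %| norm_form x)%Z ->
  exists s, norm_form x = 3 * (1 + 3 * s).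
Proof.
case: x => [[a b] d] co H3; have [k [Ea b3]] := @norm_dvd3_congr a b d co H3.
have [s E] := sqr_mod3 b3; exists (s + b * k + k ^+ 2).
rewrite norm_formE Ea; have -> : (b + 3 * k) ^+ 2 + (b + 3 * k) * b + b ^+ 2 =
  3 * (b ^+ 2 + 3 * b * k + 3 * k ^+ 2) by ring.
by rewrite E; ring.
Qed.

Lemma norm_ndvd9 x : coprimez x.1.1 x.1.2 -> ~~ (9 %| norm_form x)%Z.
Proof.
move=> co; apply/negP => H9.
have H3 : (3 %| norm_form x)%Z by apply: dvdz_trans H9.
have [s E] := norm_dvd3_third co H3; move: H9; rewrite E => /dvdzP [q]; lia.
Qed.

End Norm.

(** * The content of the addition matrix is a power of 3 *)

Lemma law_factor_norm (m g : int) (x y z w : int * int * int) :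
  on_cubic m x -> on_cubic m y ->
  law1 m x y = vscale (g * w.1.1) z -> law2 m x y = vscale (g * w.1.2) z ->
  law3 x y = vscale (g * w.2) z ->
  [/\ g ^+ 2 * (norm_form z * norm_form w) =
        (norm_form x * norm_form y) ^+ 2 + 27 * m ^+ 2 * (x.2 * y.2) ^+ 2
     * (norm_form x * y.2 ^+ 2 + norm_form y * x.2 ^+ 2),
      g ^+ 2 * (norm_form z * w.2 ^+ 2 + norm_form w * z.2 ^+ 2) =
        2 * norm_form x * norm_form y
          * (norm_form x * y.2 ^+ 2 + norm_form y * x.2 ^+ 2)
        - 27 * m ^+ 2 * (x.2 * y.2) ^+ 4
    & norm_form y * x.2 ^+ 2 - norm_form x * y.2 ^+ 2 = g * (w.2 * z.2)].
Proof.
move=> Hx Hy E1 E2 E3; have LN := law_norm Hx Hy; have LT := law_norm_mixed Hx Hy.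
have LD : (law3 x y).2 = norm_form y * x.2 ^+ 2 - norm_form x * y.2 ^+ 2.
  by case: (x) (y) => [[? ?] ?] [[? ?] ?].
move: LN LT; rewrite -LD E3 E1 E2 {E1 E2 E3 LD}.
case: z w => [[a b] d] [[a' b'] d'] /= <- <-.
by split; ring.
Qed.

Lemma ndvd3_1mod3 (s : int) : ~~ (3 %| 1 + 3 * s)%Z.
Proof. by apply/negP => /dvdzP [v]; lia. Qed.

(** When a = b modulo 3, the product of differences in [norm_disc] is divisible
    by 27, and the identity can be divided by 27. *)
Lemma norm_disc3 m x : primitive m x -> (3 %| norm_form x)%Z ->
  exists n s t, [/\ norm_form x = 3 * n, n = 1 + 3 * s &
    4 * n ^+ 3 = m ^+ 2 * x.2 ^+ 6 + 27 * t ^+ 2].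
Proof.
move=> [Hx co] H3; have [s Es] := norm_dvd3_third co H3.
case: x Hx co H3 Es => [[a b] d] Hx co H3 Es.
have [k [Ea _]] := @norm_dvd3_congr a b d co H3.
exists (1 + 3 * s), s, (k * (b + 2 * k) * (b + k)); split=> //=.
have := norm_disc Hx; rewrite Es Ea => E.
apply: (@mulfI _ 27) => //.
transitivity (4 * (3 * (1 + 3 * s)) ^+ 3); first by ring.
by rewrite E; ring.
Qed.

(** Here x, y, z, w are primitive coordinates of P, Q, P + Q, P - Q, and g is the
    content of the addition matrix, so that g divides A, B and the left-hand side
    of ED. *)
Section Content.
Variable m : int.
Variables (x y z w : int * int * int) (g : int).
Hypothesis px : primitive m x.
Hypothesis py : primitive m y.
Let A := (norm_form x * norm_form y) ^+ 2 + 27 * m ^+ 2 * (x.2 * y.2) ^+ 2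
     * (norm_form x * y.2 ^+ 2 + norm_form y * x.2 ^+ 2).
Let B := 2 * norm_form x * norm_form y
          * (norm_form x * y.2 ^+ 2 + norm_form y * x.2 ^+ 2)
        - 27 * m ^+ 2 * (x.2 * y.2) ^+ 4.
Hypothesis EA : g ^+ 2 * (norm_form z * norm_form w) = A.
Hypothesis EB : g ^+ 2 * (norm_form z * w.2 ^+ 2 + norm_form w * z.2 ^+ 2) = B.
Hypothesis ED : norm_form y * x.2 ^+ 2 - norm_form x * y.2 ^+ 2 = g * (w.2 * z.2).

Lemma norm_product_ge : (norm_form x * norm_form y) ^+ 2 <= A.
Proof.
have Nx := norm_ge1 px; have Ny := norm_ge1 py.
rewrite /A lerDl; apply: mulr_ge0.
  by apply: mulr_ge0 (sqr_ge0 _); apply: mulr_ge0 (sqr_ge0 _).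
by apply: addr_ge0; apply: mulr_ge0 (sqr_ge0 _); apply: le_trans ler01 _.
Qed.

Lemma norm_product_gt0 : 0 < A.
Proof.
apply: lt_le_trans norm_product_ge; rewrite exprn_gt0 // mulr_gt0 //.
  exact: lt_le_trans (norm_ge1 px).
exact: lt_le_trans (norm_ge1 py).
Qed.

Lemma content_neq0 : g != 0.
Proof.
by apply/eqP => g0; have := norm_product_gt0; rewrite -EA g0 expr0n /= mul0r ltxx.
Qed.

(** Write D for the left-hand side of ED. A prime p dividing A, B and D divides
    neither d_x nor d_y. Eliminating between A and B modulo D gives
    p | 243 m^2 (d_x d_y)^6 N_x d_y^2, so for p <> 3 it divides m or N_x; either
    one contradicts that the norms are prime to m. *)
Lemma content_prime (p : nat) : prime p -> (p %| g)%Z -> p = 3%N.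
Proof.
move=> pp pg; apply/eqP/negPn/negP => p3.
have pA : (p %| A)%Z by rewrite -EA expr2 -!mulrA dvdz_mulr.
have pB : (p %| B)%Z by rewrite -EB expr2 -!mulrA dvdz_mulr.
have pD : (p %| norm_form y * x.2 ^+ 2 - norm_form x * y.2 ^+ 2)%Z.
  by rewrite ED dvdz_mulr.
have X1 : (p %| norm_form x)%Z -> ~~ (p %| m)%Z /\ ~~ (p %| x.2)%Z.
  exact: norm_prime_m.
have Y1 : (p %| norm_form y)%Z -> ~~ (p %| m)%Z /\ ~~ (p %| y.2)%Z.
  exact: norm_prime_m.
move: pA pB pD X1 Y1; rewrite /A /B.
move: (norm_form x) (norm_form y) (x.2) (y.2) => N1 N2 d1 d2 pA pB pD X1 Y1.
have sq t : (p %| t ^+ 2)%Z = (p %| t)%Z by rewrite Euclid_dvdzX // andbT.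
have both : (p %| d1)%Z -> (p %| d2)%Z -> False.
  move=> p1 p2; have : (p %| (N1 * N2) ^+ 2)%Z.
    have -> : (N1 * N2) ^+ 2 = 1 * ((N1 * N2) ^+ 2 + 27 * m ^+ 2 * (d1 * d2) ^+ 2
       * (N1 * d2 ^+ 2 + N2 * d1 ^+ 2))
       + (- (27 * m ^+ 2 * (d1 * d2 ^+ 2) * (N1 * d2 ^+ 2 + N2 * d1 ^+ 2))) * d1 by ring.
    exact: dvdz_comb.
  rewrite sq Euclid_dvdzM // => /orP [/X1|/Y1] [_]; by rewrite ?p1 ?p2.
have pd1 : ~~ (p %| d1)%Z.
  apply/negP => p1; apply: both => //.
  have : (p %| N1 * d2 ^+ 2)%Z.
    have -> : N1 * d2 ^+ 2 = (-1) * (N2 * d1 ^+ 2 - N1 * d2 ^+ 2) + (N2 * d1) * d1 by ring.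
    exact: dvdz_comb.
  by rewrite Euclid_dvdzM // sq => /orP [/X1 [_]|//]; rewrite p1.
have pd2 : ~~ (p %| d2)%Z.
  apply/negP => p2; apply: both => //.
  have : (p %| N2 * d1 ^+ 2)%Z.
    have -> : N2 * d1 ^+ 2 = 1 * (N2 * d1 ^+ 2 - N1 * d2 ^+ 2) + (N1 * d2) * d2 by ring.
    exact: dvdz_comb.
  by rewrite Euclid_dvdzM // sq => /orP [/Y1 [_]|//]; rewrite p2.
have pm_absurd : (p %| m)%Z -> False.
  move=> pm; have : (p %| (N1 * N2) ^+ 2)%Z.
    have -> : (N1 * N2) ^+ 2 = 1 * ((N1 * N2) ^+ 2 + 27 * m ^+ 2 * (d1 * d2) ^+ 2
       * (N1 * d2 ^+ 2 + N2 * d1 ^+ 2))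
       + (- (27 * m * (d1 * d2) ^+ 2 * (N1 * d2 ^+ 2 + N2 * d1 ^+ 2))) * m by ring.
    exact: dvdz_comb.
  by rewrite sq Euclid_dvdzM // => /orP [/X1|/Y1] []; rewrite pm.
have p27 : ~~ (p %| 27)%Z.
  apply: contra p3 => H; have : (p %| 3%N%:Z ^+ 3)%Z by exact: H.
  by rewrite Euclid_dvdzX // andbT dvdzE /= dvdn_prime2.
have pN1_absurd : (p %| N1)%Z -> False.
  move=> p1; apply: pm_absurd.
  have : (p %| 27 * (m ^+ 2 * (d1 * d2) ^+ 4))%Z.
    have -> : 27 * (m ^+ 2 * (d1 * d2) ^+ 4) = (-1) * (2 * N1 * N2
          * (N1 * d2 ^+ 2 + N2 * d1 ^+ 2) - 27 * m ^+ 2 * (d1 * d2) ^+ 4)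
        + (2 * N2 * (N1 * d2 ^+ 2 + N2 * d1 ^+ 2)) * N1 by ring.
    exact: dvdz_comb.
  rewrite Euclid_dvdzM // (negPf p27) /= Euclid_dvdzM // sq Euclid_dvdzX // andbT.
  by rewrite Euclid_dvdzM // (negPf pd1) (negPf pd2) /= orbF.
have : (p %| 27 * (9 * (m ^+ 2 * (d1 * d2) ^+ 6 * (N1 * d2 ^+ 2))))%Z.
  pose D := N2 * d1 ^+ 2 - N1 * d2 ^+ 2.
  pose X := N1 * d2 ^+ 2; pose mu := m ^+ 2 * (d1 * d2) ^+ 6.
  have pDmul t : (p %| t * D)%Z by rewrite dvdz_mull.
  have -> : 27 * (9 * (m ^+ 2 * (d1 * d2) ^+ 6 * (N1 * d2 ^+ 2))) =
    1 * ((4 * (d1 * d2) ^+ 4) * ((N1 * N2) ^+ 2 + 27 * m ^+ 2 * (d1 * d2) ^+ 2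
       * (N1 * d2 ^+ 2 + N2 * d1 ^+ 2)) + (- (X * (d1 * d2) ^+ 2)) * (2 * N1 * N2
          * (N1 * d2 ^+ 2 + N2 * d1 ^+ 2) - 27 * m ^+ 2 * (d1 * d2) ^+ 4))
    + (- 1) * ((2 * X ^+ 3 + 2 * X ^+ 2 * D + 108 * mu) * D).
    by rewrite /X /mu /D; ring.
  apply: dvdz_comb; last exact: pDmul.
  exact: dvdz_comb.
rewrite Euclid_dvdzM // (negPf p27) /= Euclid_dvdzM //.
have -> /= : (p %| 9)%Z = false.
  apply/negP => H; case/negP: p27; have -> : 27 = 9 * 3 :> int by [].
  by rewrite dvdz_mulr.
rewrite Euclid_dvdzM // Euclid_dvdzM // sq Euclid_dvdzX // andbT.
rewrite (Euclid_dvdzM d1) // (Euclid_dvdzM N1) // sq.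
by rewrite (negPf pd1) (negPf pd2) /= !orbF => /orP [/pm_absurd|/pN1_absurd].
Qed.

(** Write N_x = 3 n_1, N_y = 3 n_2, X_1 = n_1 d_y^2 and X_2 = n_2 d_x^2. Both X_i
    are 1 modulo 3, and [norm_disc3] gives 4 X_1^3 = m^2 (d_x d_y)^6 = 4 X_2^3
    modulo 27, hence X_1 = X_2 modulo 9. Then (d_x d_y)^4 A / 81 is
    X_1^2 X_2^2 + 4 X_2^3 (X_1 + X_2) = 9 X_2^4 modulo 27. *)
Lemma norm_product_ndvd : (3 %| norm_form x)%Z -> (3 %| norm_form y)%Z ->
  ~~ (3 ^+ 7 %| A)%Z.
Proof.
move=> x3 y3; apply/negP => H7.
have [_ dx3] := norm_prime_m (isT : prime 3) px x3.
have [_ dy3] := norm_prime_m (isT : prime 3) py y3.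
have [n1 [s1 [t1 [E1 S1 F1]]]] := norm_disc3 px x3.
have [n2 [s2 [t2 [E2 S2 F2]]]] := norm_disc3 py y3.
have [u1 U1] := sqr_mod3 dx3; have [u2 U2] := sqr_mod3 dy3.
move: H7; rewrite /A E1 E2 => /dvdzP [q Hq].
move: dx3 dy3 F1 F2 U1 U2 Hq; move: (x.2) (y.2) => d1 d2 dx3 dy3 F1 F2 U1 U2 Hq.
have Hq' : (n1 * n2) ^+ 2 + m ^+ 2 * (d1 * d2) ^+ 2 * (n1 * d2 ^+ 2 + n2 * d1 ^+ 2) = 27 * q.
  apply: (@mulfI _ 81) => //; transitivity (q * 3 ^+ 7); last by ring.
  by rewrite -Hq; ring.
pose X1 := n1 * d2 ^+ 2; pose X2 := n2 * d1 ^+ 2.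
pose r := t2 ^+ 2 * d1 ^+ 6 - t1 ^+ 2 * d2 ^+ 6.
have X10 : X1 = 1 + 3 * (u2 + s1 + 3 * s1 * u2) by rewrite /X1 S1 U2; ring.
have X20 : X2 = 1 + 3 * (u1 + s2 + 3 * s2 * u1) by rewrite /X2 S2 U1; ring.
pose t := u2 + s1 + 3 * s1 * u2 - (u1 + s2 + 3 * s2 * u1).
have X12 : X1 = X2 + 3 * t by rewrite X10 X20 /t; ring.
have nX2 : ~~ (3%N %| X2)%Z.
  by rewrite X20; apply: ndvd3_1mod3.
have D4 : 4 * (X2 ^+ 3 - X1 ^+ 3) = 27 * r.
  transitivity (4 * n2 ^+ 3 * d1 ^+ 6 - 4 * n1 ^+ 3 * d2 ^+ 6); first by rewrite /X1 /X2; ring.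
  by rewrite F1 F2 /r; ring.
have : (3%N %| t * X2 ^+ 2)%Z.
  apply/dvdzP; exists (- r - 4 * (t ^+ 2 * X2 + t ^+ 3) - t * X2 ^+ 2).
  apply: (@mulfI _ 9) => //; move: D4; rewrite X12 => D4.
  have D4' : 36 * (t * X2 ^+ 2) = - (27 * r) - 108 * (t ^+ 2 * X2 + t ^+ 3).
    by rewrite -D4; ring.
  transitivity (36 * (t * X2 ^+ 2) - 27 * (t * X2 ^+ 2)); first by ring.
  by rewrite D4'; ring.
rewrite Euclid_dvdzM // Euclid_dvdzX // andbT (negPf nX2) orbF => /dvdzP [t' Et].
case/negP: nX2.
have : (3%N %| X2 ^+ 4)%Z.
  apply/dvdzP; exists (q * (d1 * d2) ^+ 4 - 2 * t' * X2 ^+ 3 - 3 * t' ^+ 2 * X2 ^+ 2 + t2 ^+ 2 * d1 ^+ 6 * (2 * X2 + 9 * t')).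
  apply: (@mulfI _ 9) => //.
  have Hm : m ^+ 2 * (d1 * d2) ^+ 6 = 4 * X2 ^+ 3 - 27 * (t2 ^+ 2 * d1 ^+ 6).
    by rewrite /X2; transitivity (4 * n2 ^+ 3 * d1 ^+ 6 - 27 * (t2 ^+ 2 * d1 ^+ 6)); [rewrite F2|]; ring.
  have Hx : X1 ^+ 2 * X2 ^+ 2 + m ^+ 2 * (d1 * d2) ^+ 6 * (X1 + X2) = 27 * q * (d1 * d2) ^+ 4.
    by rewrite -Hq' /X1 /X2; ring.
  move: Hx; rewrite Hm X12 Et => Hx.
  transitivity ((27 * q * (d1 * d2) ^+ 4) - ((X2 + 3 * (t' * 3)) ^+ 2 * X2 ^+ 2 +
     (4 * X2 ^+ 3 - 27 * (t2 ^+ 2 * d1 ^+ 6)) * (X2 + 3 * (t' * 3) + X2) - 9 * X2 ^+ 4)); last by ring.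
  by rewrite -Hx; ring.
by rewrite Euclid_dvdzX // andbT.
Qed.

End Content.

(** * A parallelogram inequality for heights *)

(** The factor 9 compensates for the content of the addition matrix, and makes
    [ht_parallelogram] hold with constant 1. *)
Definition ht (x : int * int * int) : rat :=
  (norm_form x)%:~R / (if (3 %| norm_form x)%Z then 9 else 1).

Lemma ht_ge x : 0 <= norm_form x -> (norm_form x)%:~R / 9 <= ht x.
Proof.
move=> N0; have N0' : 0 <= (norm_form x)%:~R :> rat by rewrite ler0z.
by rewrite /ht; case: ifP => _ //; rewrite divr1; lra.
Qed.

Lemma ht_le x : 0 <= norm_form x -> ht x <= (norm_form x)%:~R.
Proof.
move=> N0; have N0' : 0 <= (norm_form x)%:~R :> rat by rewrite ler0z.
by rewrite /ht; case: ifP => _ //; lra.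
Qed.

Lemma ht_gt0 m x : primitive m x -> 0 < ht x.
Proof.
move=> /norm_ge1 N1; rewrite /ht; apply: divr_gt0; last by case: ifP.
by rewrite ltr0z; apply: lt_le_trans N1.
Qed.

Lemma sqr_pow9 (g : int) : g != 0 ->
    (forall p : nat, prime p -> (p %| g)%Z -> p = 3%N) ->
  exists k, g ^+ 2 = 9 ^+ k.
Proof.
move=> g0 H; have : (3%N).-nat `|g|%N.
  apply/pnatP; first by rewrite absz_gt0.
  by move=> p pp pg; rewrite (H p pp) ?inE // dvdzE.
move=> /p_natP [k Ek]; exists k.
rewrite -[g ^+ 2]real_normK ?num_real // -abszE Ek.
by rewrite -natz natrX -exprM mulnC exprM natz.
Qed.

Lemma pow9_trivial k (t : int) : ~~ (3 %| 9 ^+ k * t)%Z -> k = 0%N.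
Proof.
case: k => // k /negP []; apply/dvdzP; exists (3 * (9 ^+ k * t)).
by rewrite exprS; ring.
Qed.

Lemma dvd9_both (a b : int) : (9 %| a * b)%Z -> ~~ (9 %| a)%Z -> ~~ (9 %| b)%Z ->
  (3 %| a)%Z /\ (3 %| b)%Z.
Proof.
have co (t : int) : ~~ (3 %| t)%Z -> coprimez 9 t.
  move=> t3; apply: coprimez_prime => p pp p9 pt; case/negP: t3.
  have : (p %| 3%N%:Z ^+ 2)%Z by exact: p9.
  rewrite Euclid_dvdzX // andbT dvdzE /= dvdn_prime2 // => /eqP E.
  by rewrite -[3]/(3%N%:Z) -E.
move=> ab a9 b9; split; apply/negPn/negP => /co c.
  by move: ab; rewrite (Gauss_dvdzr _ c) (negPf b9).
by move: ab; rewrite (Gauss_dvdzl _ c) (negPf a9).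
Qed.

(** By [law_norm], g^2 N_z N_w = A >= (N_x N_y)^2, and g is a power of 3. If 3
    divides neither N_x nor N_y, then A, hence also g and N_z N_w, is prime to 3.
    If 3 divides exactly one of them, g is prime to 3 and 9 divides A, so 3
    divides both N_z and N_w. If 3 divides both, g^2 divides 3^6, and when
    g^2 = 3^6 the norms N_z and N_w are prime to 3. *)
Lemma ht_parallelogram (m : int) (x y z w : int * int * int) (g : int) :
  primitive m x -> primitive m y -> primitive m z -> primitive m w ->
  let A := (norm_form x * norm_form y) ^+ 2 + 27 * m ^+ 2 * (x.2 * y.2) ^+ 2
     * (norm_form x * y.2 ^+ 2 + norm_form y * x.2 ^+ 2) in
  g ^+ 2 * (norm_form z * norm_form w) = A ->
  g ^+ 2 * (norm_form z * w.2 ^+ 2 + norm_form w * z.2 ^+ 2) =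
        2 * norm_form x * norm_form y
          * (norm_form x * y.2 ^+ 2 + norm_form y * x.2 ^+ 2)
        - 27 * m ^+ 2 * (x.2 * y.2) ^+ 4 ->
  norm_form y * x.2 ^+ 2 - norm_form x * y.2 ^+ 2 = g * (w.2 * z.2) ->
  ht x ^+ 2 * ht y ^+ 2 <= ht z * ht w.
Proof.
move=> px py pz pw A EA EB ED.
have g0 := content_neq0 px py EA.
have Age := norm_product_ge px py; rewrite -/A in Age.
have [k Ek] := sqr_pow9 g0 (content_prime px py EA EB ED).
have Age' : (norm_form x)%:~R ^+ 2 * (norm_form y)%:~R ^+ 2 <= A%:~R :> rat.
  by rewrite -!rmorphXn -rmorphM ler_int /= -exprMn.
have nx := norm_ge1 px; have ny := norm_ge1 py.
have nz := norm_ge1 pz; have nw := norm_ge1 pw.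
have mixed : 1 <= norm_form z -> 1 <= norm_form w ->
    ~~ (3 %| g)%Z -> (9 %| A)%Z ->
    ht x ^+ 2 * ht y ^+ 2 = (norm_form x)%:~R ^+ 2 * (norm_form y)%:~R ^+ 2 / 81 ->
    ht x ^+ 2 * ht y ^+ 2 <= ht z * ht w.
  move=> _ _ g3 A9 ->.
  have g23 : ~~ (3%N %| g ^+ 2)%Z by rewrite Euclid_dvdzX // andbT.
  rewrite Ek -[9 ^+ k]mulr1 in g23; have k0 := pow9_trivial g23.
  move: A9 EA; rewrite Ek k0 expr0 mul1r => A9 EA'; rewrite -EA' in A9.
  have [z3 w3] := dvd9_both A9 (norm_ndvd9 pz.2) (norm_ndvd9 pw.2).
  have -> : ht z * ht w = A%:~R / 81 by rewrite /ht z3 w3 -EA'; field.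
  lra.
have [x3|x3] := boolP (3 %| norm_form x)%Z; have [y3|y3] := boolP (3 %| norm_form y)%Z.
- have A7 := norm_product_ndvd px py x3 y3; rewrite -/A -EA Ek in A7.
  have kle : (k <= 3)%N.
    rewrite leqNgt; apply/negP => k4; case/negP: A7; apply: dvdz_mulr.
    by rewrite -(subnKC k4) exprD; apply: dvdz_mulr.
  have -> : ht x ^+ 2 * ht y ^+ 2 =
      (norm_form x)%:~R ^+ 2 * (norm_form y)%:~R ^+ 2 / 6561.
    by rewrite /ht x3 y3; field.
  (* only for k = 3 is the bound N / 9 <= ht too weak *)
  have [k3|k3] := eqVneq k 3%N.
    have nz3 : ~~ (3 %| norm_form z * norm_form w)%Z.
      apply: contra A7 => /dvdzP [q ->]; rewrite k3; apply/dvdzP; exists q.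
      by ring.
    have -> : ht z * ht w = A%:~R / 729.
      have z3 : (3 %| norm_form z)%Z = false.
        by apply/negP => H; case/negP: nz3; apply: dvdz_mulr.
      have w3 : (3 %| norm_form w)%Z = false.
        by apply/negP => H; case/negP: nz3; apply: dvdz_mull.
      have -> : A = 729 * (norm_form z * norm_form w) by rewrite -EA Ek k3; ring.
      by rewrite /ht z3 w3; field.
    have A0 : 0 <= A%:~R :> rat.
      by rewrite ler0z; apply: le_trans Age; apply: sqr_ge0.
    lra.
  have Nzw : norm_form z * norm_form w * 81 >= A.
    have k81 : 9 ^+ k <= 81 :> int by case: (k) k3 kle => [|[|[|[|]]]].
    rewrite -EA Ek mulrC; apply: ler_wpM2l k81.
    by apply: mulr_ge0; apply: le_trans ler01 _.
  have q9 n : 1 <= n -> 0 <= n%:~R / 9 :> rat.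
    by move=> n1; apply: divr_ge0 => //; rewrite ler0z; apply: le_trans n1.
  have z0 : 0 <= norm_form z by apply: le_trans nz.
  have w0 : 0 <= norm_form w by apply: le_trans nw.
  have Hzw := ler_pM (q9 _ nz) (q9 _ nw) (ht_ge z0) (ht_ge w0).
  apply: le_trans _ Hzw; apply: le_trans (_ : A%:~R / 6561 <= _).
    by apply: ler_wpM2r Age'; rewrite invr_ge0; apply: ler0n.
  have : A%:~R <= (norm_form z * norm_form w * 81)%:~R :> rat by rewrite ler_int.
  rewrite !rmorphM /= => Azw; lra.
- have [_ d3] := norm_prime_m (isT : prime 3) px x3.
  apply: (mixed nz nw); last first.
  + by rewrite /ht x3 (negPf y3) divr1 exprMn mulrAC.
  + have [s Es] := norm_dvd3_third px.2 x3; rewrite /A Es.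
    apply/dvdzP; exists (((1 + 3 * s) * norm_form y) ^+ 2 + 3 * m ^+ 2 * (x.2 * y.2) ^+ 2
     * (3 * (1 + 3 * s) * y.2 ^+ 2 + norm_form y * x.2 ^+ 2)).
    by ring.
  apply/negP => g3; case/negP: y3.
  have : (3%N %| norm_form y * x.2 ^+ 2)%Z.
    have -> : norm_form y * x.2 ^+ 2 =
      1 * (norm_form y * x.2 ^+ 2 - norm_form x * y.2 ^+ 2) + y.2 ^+ 2 * norm_form x.
      by ring.
    by rewrite ED; apply: dvdz_comb => //; apply: dvdz_mulr.
  by rewrite Euclid_dvdzM // Euclid_dvdzX // andbT (negPf d3) orbF.
- have [_ d3] := norm_prime_m (isT : prime 3) py y3.
  apply: (mixed nz nw); last first.
  + by rewrite /ht y3 (negPf x3) divr1 exprMn mulrA.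
  + have [s Es] := norm_dvd3_third py.2 y3; rewrite /A Es.
    apply/dvdzP; exists (((1 + 3 * s) * norm_form x) ^+ 2 + 3 * m ^+ 2 * (x.2 * y.2) ^+ 2
     * (norm_form x * y.2 ^+ 2 + 3 * (1 + 3 * s) * x.2 ^+ 2)).
    by ring.
  apply/negP => g3; case/negP: x3.
  have : (3%N %| norm_form x * y.2 ^+ 2)%Z.
    have -> : norm_form x * y.2 ^+ 2 =
      (-1) * (norm_form y * x.2 ^+ 2 - norm_form x * y.2 ^+ 2) + x.2 ^+ 2 * norm_form y.
      by ring.
    by rewrite ED; apply: dvdz_comb => //; apply: dvdz_mulr.
  by rewrite Euclid_dvdzM // Euclid_dvdzX // andbT (negPf d3) orbF.
have A3 : ~~ (3 %| A)%Z.
  apply/negP => A3; have : (3%N %| (norm_form x * norm_form y) ^+ 2)%Z.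
    have -> : (norm_form x * norm_form y) ^+ 2 = 1 * A + (- 9 * m ^+ 2 * (x.2 * y.2) ^+ 2
     * (norm_form x * y.2 ^+ 2 + norm_form y * x.2 ^+ 2)) * 3 by rewrite /A; ring.
    exact: dvdz_comb.
  by rewrite Euclid_dvdzX // andbT Euclid_dvdzM // (negPf x3) (negPf y3).
move: A3; rewrite -EA Ek => A3; have k0 := pow9_trivial A3.
rewrite k0 expr0 mul1r in A3.
have z3 : (3 %| norm_form z)%Z = false.
  by apply/negP => H; case/negP: A3; apply: dvdz_mulr.
have w3 : (3 %| norm_form w)%Z = false.
  by apply/negP => H; case/negP: A3; apply: dvdz_mull.
rewrite /ht (negPf x3) (negPf y3) z3 w3 !divr1 -rmorphM /=.
by apply: le_trans Age' _; rewrite -EA Ek k0 expr0 mul1r.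
Qed.

(** * Growth of the height along multiples *)

Lemma prim_primitive m x P : prim m x P -> primitive m x.
Proof. by case. Qed.

Lemma tau_diagonal_cadd u : cadd (Caff u u) (Caff u u) = Cinf.
Proof. by rewrite /cadd /third_point /third_affine !eqxx /= subrr eqxx. Qed.

Lemma on_C'_on_c' m P : on_C' m P -> on_c' m%:~R P.
Proof.
case: P => [|||u v] /= H; rewrite /on_c' /=; last by rewrite expr1n mulr1.
- by rewrite expr0n !(mulr0, mul0r).
- by rewrite expr0n !(mulr0, mul0r).
- by rewrite expr0n subrr !mulr0.
Qed.

Lemma prim_infinite m x P : prim m x P -> x.2 = 0 -> tau P = Cinf.
Proof.
case: x P => [[a b] d] [|||u v] //= [_ /= co [_ E1 E2]] d0.
have a0 : a = 0.
  by apply/eqP; rewrite -(intr_eq0 rat); apply/eqP; move: E1; rewrite d0 mulr1 mulr0.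
have b0 : b = 0.
  by apply/eqP; rewrite -(intr_eq0 rat); apply/eqP; move: E2; rewrite d0 mulr1 mulr0.
by rewrite a0 b0 in co.
Qed.

(** These are the points with two equal coordinates among a, b, -(a + b). *)
Lemma norm_form_eq3 (a b d : int) : norm_form (a, b, d) = 3 ->
  (a - b) * (2 * a + b) * (a + 2 * b) = 0.
Proof.
rewrite norm_formE => N3.
have a2 : -2 <= a <= 2 by apply/andP; split; nia.
have b2 : -2 <= b <= 2 by apply/andP; split; nia.
have aE : a = -2 \/ a = -1 \/ a = 0 \/ a = 1 \/ a = 2 by lia.
have bE : b = -2 \/ b = -1 \/ b = 0 \/ b = 1 \/ b = 2 by lia.
move: N3; clear a2 b2.
by case: aE => [|[|[|[|]]]] ->; case: bE => [|[|[|[|]]]] ->.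
Qed.

Section Growth.
Variable m : int.
Hypothesis m0 : m <> 0.
Variable P : c'point.
Hypothesis onP : on_c' m%:~R P.
Hypothesis ntP : nontorsion (tau P).
Let mul n := c'muln m%:~R n P.
Variable x : nat -> int * int * int.
Hypothesis Hx : forall n, prim m (x n) (mul n).

Let mQ := intr_mQ_neq0 m0.

Lemma on_mul n : on_c' m%:~R (mul n).
Proof. exact: on_muln. Qed.

Lemma tau_mul n : cmuln n (tau P) = tau (mul n).
Proof. exact: cmuln_tau. Qed.

Lemma denom_neq0 n : (0 < n)%N -> (x n).2 <> 0.
Proof.
move=> n0 /(prim_infinite (Hx n)); rewrite -tau_mul; exact: ntP.
Qed.

Lemma mul1 : mul 1 = P.
Proof. by rewrite /mul /c'muln /= c'add0. Qed.

Lemma mulS n : mul n.+1 = c'add m%:~R (mul n) (mul 1).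
Proof. by rewrite mul1 c'addC //; apply: on_mul. Qed.

Lemma mul_sub n k : mul n = c'add m%:~R (mul (n + k)) (c'opp (mul k)).
Proof.
rewrite /mul c'mulnD // -c'addA //; do ?exact: on_muln; last first.
  by apply: on_opp; apply: on_muln.
by rewrite c'addN ?c'add0 //; apply: on_muln.
Qed.

Lemma ht_step n :
  ht (x n.+1) ^+ 2 * ht (x 1%N) ^+ 2 <= ht (x n.+2) * ht (x n).
Proof.
have H2 := Hx n.+2; rewrite mulS in H2.
have H0 := Hx n; rewrite (mul_sub n 1) addn1 in H0.
have [g [E1 E2 E3]] := law_factor m0 (Hx n.+1) (Hx 1%N) H2 H0.
have [X1 _ _] := Hx n.+1; have [Y1 _ _] := Hx 1%N.
have [EA EB ED] := law_factor_norm X1 Y1 E1 E2 E3.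
apply: (ht_parallelogram _ _ _ _ EA EB ED).
- exact: prim_primitive (Hx _).
- exact: prim_primitive (Hx _).
- exact: prim_primitive H2.
- exact: prim_primitive H0.
Qed.

Lemma ht0 : ht (x 0%N) = 1.
Proof.
have := Hx 0%N; case: (x 0%N) => [[a b] d] [_ /= co [E _ _]].
have Eb : b = - a by apply: (@intr_inj rat); move: E; rewrite mulrN1 mul1r rmorphN /= => <-.
have a1 : a ^+ 2 = 1.
  move: co; rewrite Eb coprimezN coprimezE /coprime gcdnn => /eqP a1.
  by rewrite -[a ^+ 2]real_normK ?num_real // -abszE a1.
rewrite /ht norm_formE Eb; have -> : a ^+ 2 + a * - a + (- a) ^+ 2 = a ^+ 2 by ring.
by rewrite a1 /= divr1.
Qed.

Lemma ht_x_gt0 n : 0 < ht (x n).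
Proof. exact: ht_gt0 (prim_primitive (Hx n)). Qed.

Lemma disc_ge n : 27 * m ^+ 2 * (x n).2 ^+ 6 <= 4 * norm_form (x n) ^+ 3.
Proof.
have [Hc _ _] := Hx n; move: Hc; case: (x n) => [[a b] d] Hc.
by rewrite (norm_disc Hc) lerDl sqr_ge0.
Qed.

(** By [norm_disc], N = 1 is impossible. If N = 3, then tau P lies on the line
    U = V, its tangent passes through (1 : -1 : 0), and 2 tau P = 0. Otherwise
    N >= 2 is prime to 3, or N / 3 = 1 + 3s with s >= 1. *)
Lemma ht1_ge : 4 / 3 <= ht (x 1%N).
Proof.
have px := prim_primitive (Hx 1%N); have N1 := norm_ge1 px.
rewrite /ht; have [x3|x3] := boolP (3 %| _)%Z.
  have [s Es] := norm_dvd3_third px.2 x3.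
  have s0 : s != 0.
    apply/eqP => s0; move: Es; rewrite s0 => N3.
    have H := Hx 1%N; rewrite mul1 in H.
    move: H N3; case: (x 1%N) => [[a b] d] H N3.
    have diag := norm_form_eq3 N3.
    have tvE : (tau_vec (a%:~R, b%:~R, d%:~R)).1.1 = (tau_vec (a%:~R, b%:~R, d%:~R)).1.2 :> rat.
      have : ((a - b) * (2 * a + b) * (a + 2 * b))%:~R = 0 :> rat by rewrite diag.
      move=> diagQ; apply/eqP; rewrite -subr_eq0 -[X in _ == X]oppr0 -diagQ; apply/eqP.
      by rewrite /=; ring.
    have [_ _ /parP /(_ (@hvec_neq0 _)) [c Ec]] := H.
    have c0 : c != 0.
      apply: contra_not_neq (prim_neq0 H) => c0.
      by rewrite Ec c0; case: (hvec P) => [[? ?] ?]; rewrite /= !mul0r.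
    have := hvec_tau mQ onP; have := ntP (isT : (0 < 2)%N).
    have := ntP (isT : (0 < 1)%N); move: tvE; rewrite -[(_, _, _)]/(ratv (a, b, d)) Ec tau_scale.
    rewrite /cmuln /=; case: (tau P) => [|u v] //=.
    case: (tau_vec (hvec P)) (tau_vec_neq0 mQ onP) => [[u1 v1] w1] nz /=.
    move=> /(mulfI (expf_neq0 3 c0)) uv _ + [Euv Eu Ev]; apply.
    have -> : v = u.
      have [w0|w0] := eqVneq w1 0.
        by case: nz; move: Eu Ev; rewrite w0 !mulr0 !mulr1 => <- <-.
      by apply: (mulIf w0); rewrite Ev Eu uv.
    exact: tau_diagonal_cadd.
  have s1 : 1 <= s by lia.
  have : 12 <= norm_form (x 1%N) by rewrite Es; lia.
  rewrite -(ler_int rat) => ?; lra.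
have N2 : 2 <= norm_form (x 1%N).
  have d0 := denom_neq0 (isT : (0 < 1)%N).
  rewrite -[2]/(1 + 1) lezD1 lt_neqAle N1 andbT; apply/eqP => N1'.
  have := disc_ge 1; rewrite -N1' expr1n mulr1.
  have : 1 <= m ^+ 2 * (x 1%N).2 ^+ 6.
    by rewrite -gtz0_ge1 lt0r mulr_ge0 ?mulf_neq0 ?expf_neq0 ?exprn_even_ge0 //; apply/eqP.
  by rewrite -mulrA; move: (m ^+ 2 * _) => t; lia.
rewrite divr1; move: N2; rewrite -(ler_int rat) => ?; lra.
Qed.

(** The quotients ht(k+1) / ht(k) grow at least by the factor ht(1)^2 at every
    step. *)
Lemma ht_growth n : ht (x 1%N) ^+ (n ^ 2)%N <= ht (x n).
Proof.
have h0 := ht_x_gt0; set h := ht (x 1%N).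
have hp : 0 < h by apply: h0.
have ratio k : h ^+ (k.*2.+1) * ht (x k) <= ht (x k.+1).
  elim: k => [|k IH]; first by rewrite ht0 mulr1 expr1.
  have S := ht_step k; rewrite -/h in S.
  rewrite -(ler_pM2r (h0 k)); apply: le_trans S.
  have -> : h ^+ k.+1.*2.+1 * ht (x k.+1) * ht (x k) =
    (h ^+ 2 * ht (x k.+1)) * (h ^+ k.*2.+1 * ht (x k)).
    by rewrite doubleS !exprS; ring.
  have -> : ht (x k.+1) ^+ 2 * h ^+ 2 = (h ^+ 2 * ht (x k.+1)) * ht (x k.+1) by ring.
  by apply: ler_wpM2l IH; rewrite mulr_ge0 ?sqr_ge0 // ltW.
elim: n => [|n IH]; first by rewrite ht0 expr0.
apply: le_trans (ratio n).
have -> : (n.+1 ^ 2 = n.*2.+1 + n ^ 2)%N by rewrite -addn1 sqrnD -muln2; lia.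
by rewrite exprD ler_wpM2l // exprn_ge0 // ltW.
Qed.

End Growth.

(** * The denominator of an image under tau *)

Lemma tau_vec_ratv x : ratv (tau_vec x) = tau_vec (ratv x).
Proof.
by case: x => [[a b] d]; rewrite /=; congr (_, _, _); ring.
Qed.

Lemma on_fermat_ratv m x : on_fermat m%:~R (ratv x) <-> on_fermat m x.
Proof.
case: x => [[a b] d]; rewrite /= -!rmorphXn -rmorphD -!rmorphM /=.
by split=> [/intr_inj|->].
Qed.

Section Lowest.
Variable m : int.
Hypothesis m0 : m <> 0.
Hypothesis cfm : cube_free m.
Let mQ := intr_mQ_neq0 m0.

Lemma lowest_coprime P U V W : on_c' m%:~R P -> lowest_terms (tau P) U V W ->
  [/\ coprimez U V, on_fermat m (U, V, W) & par (hvecC (tau P)) (ratv (U, V, W))].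
Proof.
move=> HP [E W1 g1].
have W0 : W%:~R != 0 :> rat by rewrite intr_eq0; apply: lt0r_neq0; apply: lt_le_trans W1.
have par1 : par (hvecC (tau P)) (ratv (U, V, W)).
  by rewrite E; split; rewrite /=; field; rewrite W0.
have nz : ratv (U, V, W) <> (0, 0, 0) by case=> _ _ /eqP; apply/negP.
have HF : on_fermat m (U, V, W).
  apply/on_fermat_ratv; have := tau_on_C mQ HP.
  have /parP /(_ (@hvecC_neq0 _)) [c Ec] := par_sym par1.
  rewrite Ec; case: (hvecC _) => [[a b] d] /= H.
  transitivity (c ^+ 3 * (a ^+ 3 + b ^+ 3)); first by ring.
  by rewrite H; ring.
split=> //; apply: coprimez_prime => p pp pU pV.
have pW : ~~ (p %| W)%Z.
  apply/negP => pW; have : (p %| gcdz (gcdz U V) W)%Z by rewrite !dvdz_gcd pU pV.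
  by rewrite g1 dvdz1 => /eqP Ep; move: pp; rewrite -[p]/(`|p|%N) Ep.
apply: (cfm pp).
have p3W : coprimez (p ^ 3)%N (W ^+ 3).
  by rewrite coprimezE abszX /= coprimeXl // coprimeXr // prime_coprime.
rewrite -(Gauss_dvdzl _ p3W) -HF.
have [U' ->] := dvdzP pU; have [V' ->] := dvdzP pV.
apply/dvdzP; exists (U' ^+ 3 + V' ^+ 3).
by rewrite !expnS expn0 muln1 !PoszM; ring.
Qed.

Lemma lowest_factor x P U V W : prim m x P -> lowest_terms (tau P) U V W ->
  exists h, tau_vec x = vscale h (U, V, W).
Proof.
move=> px lP; have HP := prim_on px; have [co _ par1] := lowest_coprime HP lP.
apply: par_coprime => //; apply/par_ratv; rewrite tau_vec_ratv.
have [_ _ /parP /(_ (@hvec_neq0 _)) [c ->]] := px.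
rewrite tau_scale; apply: par_scalel.
exact: par_trans (@hvecC_neq0 _) (par_sym (hvec_tau mQ HP)) par1.
Qed.

(** The first two forms of [tau_vec] add up to 9ab(a+b), and modulo a, b or a+b
    the first one is a cube up to sign; so a common factor divides 9. Modulo 3 it
    is b - a, and for a = b + 3k both forms are divisible by 9. *)
Lemma lowest_content x P U V W h : prim m x P -> lowest_terms (tau P) U V W ->
  tau_vec x = vscale h (U, V, W) ->
  `|h|%N = if (3 %| norm_form x)%Z then 9%N else 1%N.
Proof.
move=> px lP; have [co _ _] := lowest_coprime (prim_on px) lP.
case: x px => [[a b] d] [Hx /= cab _] [EU EV EW].
have sumE : h * (U + V) = 9 * (a * b * (a + b)) by rewrite mulrDr -EU -EV; ring.
have hcop : coprimez h (a * b * (a + b)).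
  apply: coprimez_prime => p pp ph; rewrite !Euclid_dvdzM // -orbA.
  have pU : (p %| - a ^+ 3 + 3 * a ^+ 2 * b + 6 * a * b ^+ 2 + b ^+ 3)%Z.
    by rewrite EU dvdz_mulr.
  have bad : (p %| a)%Z -> (p %| b)%Z -> False by apply: prime_coprimez.
  move=> /or3P [pa|pb|pab].
  - apply: bad => //; have : (p %| b ^+ 3)%Z.
      have -> : b ^+ 3 = 1 * (- a ^+ 3 + 3 * a ^+ 2 * b + 6 * a * b ^+ 2 + b ^+ 3)
        + (a ^+ 2 - 3 * a * b - 6 * b ^+ 2) * a by ring.
      exact: dvdz_comb.
    by rewrite Euclid_dvdzX // andbT.
  - apply: bad => //; have : (p %| a ^+ 3)%Z.
      have -> : a ^+ 3 = (-1) * (- a ^+ 3 + 3 * a ^+ 2 * b + 6 * a * b ^+ 2 + b ^+ 3)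
        + (b ^+ 2 + 3 * a ^+ 2 + 6 * a * b) * b by ring.
      exact: dvdz_comb.
    by rewrite Euclid_dvdzX // andbT.
  - have pb : (p %| b)%Z.
      have : (p %| b ^+ 3)%Z.
        have -> : b ^+ 3 = (-1) * (- a ^+ 3 + 3 * a ^+ 2 * b + 6 * a * b ^+ 2 + b ^+ 3)
          + (- a ^+ 2 + 4 * a * b + 2 * b ^+ 2) * (a + b) by ring.
        exact: dvdz_comb.
      by rewrite Euclid_dvdzX // andbT.
    apply: bad => //; have -> : a = 1 * (a + b) + (-1) * b by ring.
    exact: dvdz_comb.
have h9 : (`|h| %| 9)%N.
  have : (h %| 9 * (a * b * (a + b)))%Z by rewrite -sumE dvdz_mulr.
  by rewrite Gauss_dvdzl // dvdzE.
have [n3|n3] := boolP (3 %| norm_form (a, b, d))%Z.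
  have [k [Ea b3]] := norm_dvd3_congr cab n3.
  have : (9 %| h)%Z.
    have /coprimezP [[u v] /= uv] := co.
    have -> : h = u * (h * U) + v * (h * V) by rewrite -[LHS]mul1r -uv; ring.
    apply: dvdz_comb.
      rewrite -EU Ea; apply/dvdzP; exists (b ^+ 3 + 3 * b ^+ 2 * k - 3 * k ^+ 3); ring.
    rewrite -EV Ea; apply/dvdzP; exists (b ^+ 3 + 6 * b ^+ 2 * k + 9 * b * k ^+ 2 + 3 * k ^+ 3); ring.
  by rewrite dvdzE => H; apply/eqP; rewrite eqn_dvd h9.
have h3 : ~~ (3 %| `|h|)%N.
  apply: contra n3 => h3; have {}h3 : (3 %| h)%Z by rewrite dvdzE.
  have : (3%N %| (a - b) ^+ 3)%Z.
    have -> : (a - b) ^+ 3 = (- U) * h + (3 * a * b ^+ 2) * 3.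
      by rewrite mulNr [U * h]mulrC -EU; ring.
    exact: dvdz_comb.
  rewrite Euclid_dvdzX // andbT => ab3; rewrite norm_formE.
  have -> : a ^+ 2 + a * b + b ^+ 2 = (a - b) * (a - b) + (a * b) * 3 by ring.
  exact: dvdz_comb.
move: h9 h3 (dvdn_leq (isT : (0 < 9)%N) h9).
by case: (`|h|%N) => [|[|[|[|[|[|[|[|[|[|]]]]]]]]]].
Qed.

Lemma denom_formula x P U V W : prim m x P -> lowest_terms (tau P) U V W ->
  if (3 %| norm_form x)%Z then 3 * W = `|x.2| * norm_form x
  else W = `|x.2| * (3 * norm_form x).
Proof.
move=> px lP; have [h Eh] := lowest_factor px lP.
have := lowest_content px lP Eh; have [_ W1 _] := lP.
have N1 := norm_ge1 (prim_primitive px).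
case: x px Eh N1 => [[a b] d] px [_ _ EW] N1 hE.
have : `|h| * W = 3 * `|d| * norm_form (a, b, d).
  have -> : 3 * `|d| * norm_form (a, b, d) = `|3 * d * norm_form (a, b, d)|.
    by rewrite !normrM (ger0_norm (le_trans ler01 N1)).
  by rewrite EW normrM (ger0_norm (le_trans ler01 W1)).
rewrite -abszE hE /=; case: ifP => _ E.
  by apply: (@mulfI _ 3) => //; rewrite mulrA E mulrA.
by rewrite mul1r in E; rewrite E mulrA [`|d| * 3]mulrC.
Qed.

(** Nothing cancels in the dual isogeny, as U and V are coprime. *)
Lemma triple_prim P U V W : on_c' m%:~R P -> lowest_terms (tau P) U V W ->
  prim m (V ^+ 3, U ^+ 3, U * V * W) (c'muln m%:~R 3 P).
Proof.
move=> HP lP; have [co HF par1] := lowest_coprime HP lP.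
have HPP := on_add mQ HP HP; have O := on_O m%:~R.
have E3 : c'muln m%:~R 3 P = c'add m%:~R P (c'add m%:~R P P).
  by rewrite /c'muln /= c'add0.
split.
- rewrite /= in HF; rewrite /=.
  transitivity ((U * V) ^+ 3 * (U ^+ 3 + V ^+ 3)); first by ring.
  by rewrite HF; ring.
- by rewrite /= coprimezE !abszX coprimeXl // coprimeXr // -coprimezE coprimez_sym.
have /par_sym /parP /(_ (@tau_vec_neq0 _ mQ _ HP)) [c Ec] :=
  par_trans (@hvecC_neq0 _) (par_sym (hvec_tau mQ HP)) par1.
have n2 : law m%:~R true (hvec P) (hvec P) <> (0, 0, 0).
  have [[] //] := law_neq0 mQ HP HP (@hvec_neq0 _) (@hvec_neq0 _).
  move=> + E; apply; rewrite -[false]/(~~ true).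
  have := lawC m%:~R (hvec P) (hvec P) true; rewrite E.
  by case: (law _ _ _ _) => [[p1 p2] p3] [/esym /eqP + /esym /eqP + /esym /eqP];
     rewrite !mulN1r !oppr_eq0 => /eqP -> /eqP -> /eqP ->.
have H2 := on_cubic_law true HP HP.
have [i n3] := law_neq0 mQ HP H2 (@hvec_neq0 _) n2.
have L3 := law_hvec mQ i HP HPP (parxx _) (law_hvec mQ true HP HP (parxx _) (parxx _)).
rewrite E3; apply: par_trans n3 _ L3; apply: par_sym.
have := triple_law i HP; move: Ec; case: (tau_vec (hvec P)) (tau_vec_neq0 mQ HP) => [[u v] w] nz.
move=> [EU EV EW] T.
apply: par_trans _ T _.
  case=> /eqP + /eqP + _; rewrite !expf_eq0 /= => /eqP v0 /eqP u0.
  move: EU EV; rewrite v0 u0 !mulr0 => /eqP + /eqP; rewrite !intr_eq0.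
  by move=> /eqP U0 /eqP V0; rewrite U0 V0 in co.
have -> : ratv (V ^+ 3, U ^+ 3, U * V * W) = vscale (c ^+ 3) (v ^+ 3, u ^+ 3, u * v * w).
  rewrite /=; congr (_, _, _).
  - by rewrite rmorphXn /= EV; ring.
  - by rewrite rmorphXn /= EU; ring.
  - by rewrite !rmorphM /= EU EV EW; ring.
exact/par_sym/par_scale.
Qed.

End Lowest.

(** * Multiples of a point near the identity modulo q *)

(** Reduction modulo q to the identity (1 : -1 : 0). *)
Definition near_id (q : int) (y : int * int * int) :=
  (q %| y.2)%Z /\ (q %| y.1.1 + y.1.2)%Z.

(** The group law to first order: d/a is additive modulo Q^4. The error is of
    order 4 because a + b = m d^3 / (ab) has order 3. *)
Lemma law1_near (m Q : int) (x y : int * int * int) :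
  near_id Q x -> near_id Q y -> (Q ^+ 3 %| x.1.1 + x.1.2)%Z -> (Q ^+ 3 %| y.1.1 + y.1.2)%Z ->
  let w := law1 m x y in
  [/\ (Q ^+ 3 %| w.1.1 - (x.1.1 * y.1.1) ^+ 2)%Z, (Q ^+ 3 %| w.1.1 + w.1.2)%Z,
      (Q %| w.2)%Z &
      (Q ^+ 4 %| w.2 - x.1.1 * y.1.1 * (x.1.1 * y.2 + y.1.1 * x.2))%Z].
Proof.
case: x y => [[a1 b1] d1] [[a2 b2] d2] [/dvdzP [e1 D1] _] [/dvdzP [e2 D2] _].
move=> /dvdzP [c1 E1] /dvdzP [c2 E2]; rewrite /= in D1 D2 E1 E2 *.
rewrite D1 D2 {d1 d2 D1 D2}.
have -> : b1 = c1 * Q ^+ 3 - a1 by rewrite -E1; ring.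
have -> : b2 = c2 * Q ^+ 3 - a2 by rewrite -E2; ring.
set B1 := c1 * Q ^+ 3 - a1; set B2 := c2 * Q ^+ 3 - a2.
pose C1 := c1 * Q ^+ 3; pose C2 := c2 * Q ^+ 3.
split.
- apply/dvdzP; exists (- (a1 ^+ 2 * a2 * c2 + B1 * c1 * C2 ^+ 2
    + 3 * m * e1 * e2 * (a1 * e2 + C2 * e1))).
  by rewrite /B1 /B2 /C2; ring.
- apply/dvdzP; exists (a1 * B2 * (c1 * C2 - c1 * a2 - a1 * c2) - B1 * c1 * C2 ^+ 2
    + c1 * C1 * a2 * C2 + 3 * m * e1 * e2 * (C1 * e2 + B2 * e1 - (a1 * e2 + C2 * e1))).
  by rewrite /B1 /B2 /C1 /C2; ring.
- by apply: rpredD; rewrite mulrAC; apply: dvdz_mull.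
apply/dvdzP; exists (e2 * (B1 ^+ 2 * c2 + 2 * a1 * (c1 * C2 - c1 * a2 - a1 * c2))
  + e1 * (c1 * B2 ^+ 2 - a1 * c2 * C2 - c1 * a2 ^+ 2)).
by rewrite /B1 /B2 /C2; ring.
Qed.

Lemma small_valuation j l : (0 < j)%N -> (l <= 1)%N -> ((j + l).+1 <= j * 4)%N.
Proof. lia. Qed.

Lemma quotient_lt n N n' q : (1 < q)%N -> (0 < n')%N -> (n < N.+1)%N ->
  n.+1 = (n' * q)%N -> (n'.-1 < N)%N.
Proof. nia. Qed.

Section Local.
Variable m : int.
Hypothesis m0 : m <> 0.
Variable q : nat.
Hypothesis q_prime : prime q.
Let mQ := intr_mQ_neq0 m0.

Lemma near_unit y : primitive m y -> near_id q y -> ~~ (q %| y.1.1)%Z /\ ~~ (q %| y.1.2)%Z.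
Proof.
case: y => [[a b] d] [_ /= co] [_ /= qab].
have bad : (q %| a)%Z -> (q %| b)%Z -> False by apply: prime_coprimez.
split; apply/negP => qa; apply: bad => //.
  have -> : b = 1 * (a + b) + (-1) * a by ring.
  exact: dvdz_comb.
have -> : a = 1 * (a + b) + (-1) * b by ring.
exact: dvdz_comb.
Qed.

Lemma dvdz_expE (i : nat) (t : int) : t != 0 ->
  (q%:Z ^+ i %| t)%Z = (i <= logn q `|t|)%N.
Proof.
by move=> t0; rewrite dvdzE abszX /= pfactor_dvdn // absz_gt0.
Qed.

Lemma coprime_expz i (t : int) : ~~ (q %| t)%Z -> coprimez (q%:Z ^+ i) t.
Proof.
move=> qt; rewrite coprimezE abszX /= coprimeXl // prime_coprime //.
Qed.

Lemma near_cube y j : primitive m y -> near_id q y -> (q%:Z ^+ j %| y.2)%Z ->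
  ((q%:Z ^+ j) ^+ 3 %| y.1.1 + y.1.2)%Z.
Proof.
move=> py ny; have [qa qb] := near_unit py ny; case: py => + _.
case: y ny qa qb => [[a b] d] _ /= qa qb Hc /dvdzP [e Ed].
have co : coprimez ((q%:Z ^+ j) ^+ 3) (a * b).
  by rewrite -exprM coprime_expz // Euclid_dvdzM // negb_or qa.
by rewrite -(Gauss_dvdzr _ co) Hc Ed; apply/dvdzP; exists (m * e ^+ 3); ring.
Qed.

Section Chain.
Variables (y : int * int * int) (P : c'point) (j : nat).
Hypothesis py : prim m y P.
Hypothesis ny : near_id q y.
Hypothesis j0 : (0 < j)%N.
Hypothesis yj : (q%:Z ^+ j %| y.2)%Z.
Let Q := q%:Z ^+ j.

Lemma q_dvd_Q : (q %| Q)%Z.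
Proof. by rewrite /Q -(prednK j0) exprS dvdz_mulr. Qed.

Lemma near_chain k : exists w : int * int * int,
  [/\ par (ratv w) (hvec (c'muln m%:~R k.+1 P)), ~~ (q %| w.1.1)%Z,
    (Q ^+ 3 %| w.1.1 + w.1.2)%Z, (Q %| w.2)%Z &
    (Q ^+ 4 %| w.2 * y.1.1 - k.+1%:Z * w.1.1 * y.2)%Z].
Proof.
have pp := prim_primitive py; have [qa _] := near_unit pp ny.
have y3 := near_cube pp ny yj.
have HP := prim_on py.
elim: k => [|k [w [W1 W2 W3 W4 W5]]].
  exists y; split => //; last by rewrite mul1r mulrC subrr dvdz0.
  rewrite /c'muln /= c'add0 //; by case: py.
exists (law1 m w y).
have nQ : near_id Q y.
  by split=> //; apply: dvdz_trans y3; rewrite [X in (_ %| X)%Z]exprS dvdz_mulr.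
have nw : near_id Q w.
  by split=> //; apply: dvdz_trans W3; rewrite [X in (_ %| X)%Z]exprS dvdz_mulr.
have [L1 L2 L3 L4] := law1_near m nw nQ W3 y3.
split=> //.
- rewrite -[k.+2]addn1 c'mulnD // -[law1 m w y]/(law m true w y) law_ratv.
  apply: (law_hvec mQ true (on_muln mQ k.+1 HP) (on_muln mQ 1 HP) W1).
  by rewrite /c'muln /= c'add0 //; case: py.
- apply/negP => qw; have qQ3 : (q %| Q ^+ 3)%Z.
    by rewrite exprS; apply: dvdz_mulr; exact: q_dvd_Q.
  have : (q %| (w.1.1 * y.1.1) ^+ 2)%Z.
    have -> : (w.1.1 * y.1.1) ^+ 2 = 1 * (law1 m w y).1.1 +
       (-1) * ((law1 m w y).1.1 - (w.1.1 * y.1.1) ^+ 2) by ring.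
    apply: dvdz_comb => //; exact: dvdz_trans L1.
  by rewrite Euclid_dvdzX // andbT Euclid_dvdzM // (negPf W2) (negPf qa).
have [u Eu] := dvdzP L1; have [v Ev] := dvdzP L4; have [s Es] := dvdzP W5.
have [e Ee] := dvdzP yj.
apply/dvdzP; exists (v * y.1.1 - k.+2%:Z * u * e + w.1.1 * y.1.1 ^+ 2 * s).
have -> : (law1 m w y).1.1 = u * Q ^+ 3 + (w.1.1 * y.1.1) ^+ 2 by rewrite -Eu; ring.
have -> : (law1 m w y).2 = v * Q ^+ 4 + w.1.1 * y.1.1 * (w.1.1 * y.2 + y.1.1 * w.2).
  by rewrite -Ev; ring.
have -> : k.+2%:Z = k.+1%:Z + 1 by rewrite -addn1 PoszD.
transitivity ((v * y.1.1) * Q ^+ 4 - (k.+1%:Z + 1) * u * Q ^+ 3 * y.2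
  + w.1.1 * y.1.1 ^+ 2 * (w.2 * y.1.1 - k.+1%:Z * w.1.1 * y.2)); first by ring.
by rewrite Es [in (_ * Q ^+ 3) * y.2]Ee -/Q; ring.
Qed.

End Chain.

(** Near the identity d/a is a local parameter, additive modulo q^(4j) when q^j
    is the power of q in it. Multiplication by k raises its valuation j by that of
    k as long as the result stays below 4j. *)
Lemma near_mult k y z P : prim m y P -> near_id q y -> y.2 != 0 ->
    prim m z (c'muln m%:~R k.+1 P) ->
  near_id q z /\ (logn q k.+1 <= 1 -> z.2 != 0 ->
    logn q `|z.2| <= logn q `|y.2| + logn q k.+1)%N.
Proof.
move=> py ny y0 pz; pose j := logn q `|y.2|.
have j0 : (0 < j)%N by rewrite -dvdz_expE // expr1; case: ny.
have yj : (q%:Z ^+ j %| y.2)%Z by rewrite dvdz_expE.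
have [w [W1 W2 W3 W4 W5]] := near_chain py ny j0 yj k.
have [_ coz Z3] := pz.
have [|c Ec] := @par_coprime w z coz.
  by apply/par_ratv; apply: par_trans (@hvec_neq0 _) W1 (par_sym Z3).
have Ew1 : w.1.1 = c * z.1.1 by rewrite Ec; case: (z) => [[? ?] ?].
have Ew2 : w.1.2 = c * z.1.2 by rewrite Ec; case: (z) => [[? ?] ?].
have Ew3 : w.2 = c * z.2 by rewrite Ec; case: (z) => [[? ?] ?].
have qc : ~~ (q %| c)%Z by apply: contra W2 => qc; rewrite Ew1 dvdz_mulr.
have qQ : (q %| q%:Z ^+ j)%Z := q_dvd_Q j0.
split.
  split.
    have : (q %| w.2)%Z by apply: dvdz_trans W4.
    by rewrite Ew3 Euclid_dvdzM // (negPf qc).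
  have : (q %| w.1.1 + w.1.2)%Z.
    by apply: dvdz_trans W3; rewrite [X in (_ %| X)%Z]exprS; apply: dvdz_mulr.
  by rewrite Ew1 Ew2 -mulrDr Euclid_dvdzM // (negPf qc).
move=> k1 z0; rewrite leqNgt; apply/negP; rewrite -/j => lt.
pose i := (j + logn q k.+1).+1.
have iz : (q%:Z ^+ i %| w.2)%Z by rewrite Ew3; apply: dvdz_mull; rewrite dvdz_expE.
have iQ : (q%:Z ^+ i %| (q%:Z ^+ j) ^+ 4)%Z.
  have i4 : (i <= j * 4)%N by apply: small_valuation.
  by rewrite -exprM -(subnKC i4) exprD dvdz_mulr.
have w10 : w.1.1 != 0 by apply: contraNneq W2 => ->; apply: dvdz0.
have nz : k.+1%:Z * w.1.1 * y.2 != 0 by rewrite !mulf_neq0.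
have : (q%:Z ^+ i %| k.+1%:Z * w.1.1 * y.2)%Z.
  have -> : k.+1%:Z * w.1.1 * y.2 = y.1.1 * w.2 +
    (-1) * (w.2 * y.1.1 - k.+1%:Z * w.1.1 * y.2) by ring.
  by apply: dvdz_comb => //; apply: dvdz_trans iQ _.
rewrite dvdz_expE // !abszM !lognM ?muln_gt0 ?absz_gt0 //=.
have -> : logn q `|w.1.1| = 0%N.
  by apply/eqP; rewrite -leqn0 leqNgt -dvdz_expE // expr1.
by rewrite addn0 /i -/j addnC ltnn.
Qed.

(** The prime factors q of n are split off one at a time, so that [near_mult]
    applies at every stage. *)
Lemma near_logn n y z P : prim m y P -> near_id q y ->
    (forall k t, prim m t (c'muln m%:~R k.+1 P) -> t.2 != 0) -> cube_free m ->
    prim m z (c'muln m%:~R n.+1 P) ->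
  (logn q `|z.2| <= logn q `|y.2| + logn q n.+1)%N.
Proof.
have [N] := ubnP n; elim: N n y z P => // N IH n y z P ltn py ny nt cf pz.
have HP := prim_on py.
have y0 : y.2 != 0 by apply: (nt 0%N); rewrite /c'muln /= c'add0.
have z0 := nt _ _ pz; have [_ near_bound] := near_mult py ny y0 pz.
have [qn|qn] := boolP (q %| n.+1)%N; last first.
  by apply: near_bound => //; rewrite logn_coprime // prime_coprime.
have [n' En] := dvdnP qn.
have q1 := prime_gt1 q_prime.
have n'0 : (0 < n')%N by case: n' En => //.
have [t pt] := prim_exists cf (on_muln mQ q HP).
have qE : q = q.-1.+1 by rewrite prednK // prime_gt0.
have n'E : n' = n'.-1.+1 by rewrite prednK.
rewrite qE in pt.
have [nt_t bound_t] := near_mult py ny y0 pt.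
have pz' : prim m z (c'muln m%:~R n'.-1.+1 (c'muln m%:~R q.-1.+1 P)).
  by rewrite -c'mulnM // -n'E -qE -En.
have lt' : (n'.-1 < N)%N by apply: quotient_lt ltn En.
have nt' k s : prim m s (c'muln m%:~R k.+1 (c'muln m%:~R q.-1.+1 P)) -> s.2 != 0.
  by rewrite -c'mulnM // mulSn addSn; apply: nt.
have := IH _ _ _ _ lt' pt nt_t nt' cf pz'.
rewrite -n'E => /leq_trans; apply.
have bound_q : (logn q `|t.2| <= logn q `|y.2| + 1)%N.
  have -> : 1%N = logn q q.-1.+1 by rewrite -qE logn_prime // eqxx.
  apply: bound_t; last exact: nt pt.
  by rewrite -qE logn_prime // eqxx.
have -> : logn q n.+1 = (logn q n' + 1)%N.
  rewrite En lognM // ?prime_gt0 //.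
  by rewrite (logn_prime q q_prime) eqxx.
by rewrite (addnC (logn q n')) addnA leq_add2r.
Qed.

(** Modulo q the point Q is the identity, so P + Q reduces to the same point as
    P. *)
Lemma near_norm x y z P Q : prim m x P -> prim m y Q -> near_id q y ->
    prim m z (c'add m%:~R P Q) -> (q %| norm_form x)%Z -> (q %| norm_form z)%Z.
Proof.
move=> px py ny pz qN; have [qa qb] := near_unit (prim_primitive py) ny.
have [_ cox _] := px; have [_ coz _] := pz.
have [c1 E1] := par_coprime coz (law_prim m0 true px py pz).
have [c2 E2] := par_coprime coz (law_prim m0 false px py pz).
move: ny qN E1 E2; rewrite /law /near_id.
case: x px cox => [[a b] d] px /= cox; case: y py qa qb => [[a2 b2] d2] py qa qb /=.
case: z pz coz => [[a3 b3] d3] pz coz [/dvdzP [e2 E2] /dvdzP [f2 F2]].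
rewrite /= in E2 F2 qa qb; rewrite norm_formE => qN.
have Eb2 : b2 = f2 * q%:Z - a2 by rewrite -F2; ring.
move=> [A1 B1 _] [A2 B2 _].
have bad : (q %| a)%Z -> (q %| b)%Z -> False by apply: prime_coprimez.
(* modulo q the columns are a2^2 a and a2^2 b times the coordinates of P *)
have cong1 : exists u v, c1 * a3 = a2 ^+ 2 * (a * a) + u * q%:Z /\
    c1 * b3 = a2 ^+ 2 * (a * b) + v * q%:Z.
  rewrite -A1 -B1 E2 Eb2.
  exists (- (a ^+ 2 * a2 * f2 + b * (a + b) * f2 ^+ 2 * q%:Z
    + 3 * m * d * e2 * (a * (e2 * q%:Z) + f2 * q%:Z * d))).
  exists ((a + b) ^+ 2 * a2 * f2 + a * b * (f2 ^+ 2 * q%:Z - 2 * f2 * a2)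
    + 3 * m * d * e2 * ((a + b) * (e2 * q%:Z) + (f2 * q%:Z - a2) * d)).
  by split; ring.
have cong2 : exists u v, c2 * a3 = a2 ^+ 2 * (b * a) + u * q%:Z /\
    c2 * b3 = a2 ^+ 2 * (b * b) + v * q%:Z.
  rewrite -A2 -B2 E2 Eb2.
  exists ((b + a) ^+ 2 * (f2 * q%:Z - a2) * f2 + b * a * 0
    + 3 * m * d * e2 * ((b + a) * (e2 * q%:Z) + a2 * d)).
  exists (- (b ^+ 2 * a2 * f2 + a * (a + b) * f2 ^+ 2 * q%:Z
    + 3 * m * d * e2 * (b * (e2 * q%:Z) + f2 * q%:Z * d)) + 2 * b ^+ 2 * a2 * f2 * 0).
  by split; ring.
have [u1 [v1 [C1 D1]]] := cong1; have [u2 [v2 [C2 D2]]] := cong2.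
have key c s u v : c * a3 = a2 ^+ 2 * (s * a) + u * q%:Z ->
    c * b3 = a2 ^+ 2 * (s * b) + v * q%:Z ->
    (q %| c ^+ 2 * (a3 ^+ 2 + a3 * b3 + b3 ^+ 2))%Z.
  move=> Ca Cb.
  have -> : c ^+ 2 * (a3 ^+ 2 + a3 * b3 + b3 ^+ 2) =
    (c * a3) ^+ 2 + (c * a3) * (c * b3) + (c * b3) ^+ 2 by ring.
  rewrite Ca Cb.
  have -> : (a2 ^+ 2 * (s * a) + u * q%:Z) ^+ 2 + (a2 ^+ 2 * (s * a) + u * q%:Z)
    * (a2 ^+ 2 * (s * b) + v * q%:Z) + (a2 ^+ 2 * (s * b) + v * q%:Z) ^+ 2 =
    (a2 ^+ 4 * s ^+ 2) * (a ^+ 2 + a * b + b ^+ 2) +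
    (2 * a2 ^+ 2 * (s * a) * u + u ^+ 2 * q%:Z + a2 ^+ 2 * s * (a * v + b * u)
     + u * v * q%:Z + 2 * a2 ^+ 2 * (s * b) * v + v ^+ 2 * q%:Z) * q%:Z by ring.
  exact: dvdz_comb.
apply/negPn/negP => qz.
have K1 := key _ _ _ _ C1 D1; have K2 := key _ _ _ _ C2 D2.
move: K1 K2; rewrite !(Euclid_dvdzM _ _ q_prime) (negPf qz) !orbF !orbb.
move=> qc1 qc2.
have drop c s t u : (q %| c)%Z -> c * t = a2 ^+ 2 * (s * s) + u * q%:Z -> (q %| s)%Z.
  move=> qc Ec; have : (q %| a2 ^+ 2 * (s * s))%Z.
    have -> : a2 ^+ 2 * (s * s) = t * c + (- u) * q%:Z by rewrite [t * c]mulrC Ec; ring.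
    exact: dvdz_comb.
  by rewrite !(Euclid_dvdzM _ _ q_prime) (negPf qa) /= orbb.
by apply: bad; [exact: drop C1 | exact: drop D2].
Qed.

End Local.

(** * Prime divisors of the denominators W_n *)

Lemma norm_le_pos (a b : int) : 1 <= a -> 1 <= b ->
  a ^+ 2 + a * b + b ^+ 2 <= a * b * (a + b) + 1.
Proof.
move=> a1 b1; rewrite -subr_ge0.
have -> : a * b * (a + b) + 1 - (a ^+ 2 + a * b + b ^+ 2) =
  (a - 1) * (b - 1) * ((a - 1) + (b - 1) + 3) by ring.
have a0 : 0 <= a - 1 by rewrite subr_ge0.
have b0 : 0 <= b - 1 by rewrite subr_ge0.
by rewrite mulr_ge0 ?mulr_ge0 // addr_ge0 // addr_ge0.
Qed.

(** Up to order and sign, a, b and -(a + b) are two positive integers and minus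
    their sum; N and the absolute value of the product are not affected. *)
Lemma norm_le_product (a b : int) : a * b * (a + b) != 0 ->
  a ^+ 2 + a * b + b ^+ 2 <= `|a * b * (a + b)| + 1.
Proof.
rewrite !mulf_eq0 !negb_or => /andP [/andP [a0 b0] ab0].
have [a1|a1] : 1 <= a \/ 1 <= - a by lia.
- have [b1|b1] : 1 <= b \/ 1 <= - b by lia.
    by apply: le_trans (norm_le_pos a1 b1) _; rewrite lerD2r ler_norm.
  have [c1|c1] : 1 <= a + b \/ 1 <= - (a + b) by lia.
    have := norm_le_pos b1 c1; rewrite -[`|_|]normrN.
    have -> : (- b) ^+ 2 + - b * (a + b) + (a + b) ^+ 2 = a ^+ 2 + a * b + b ^+ 2 by ring.
    have -> : - b * (a + b) * (- b + (a + b)) = - (a * b * (a + b)) by ring.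
    by move/le_trans; apply; rewrite lerD2r ler_norm.
  have := norm_le_pos a1 c1.
  have -> : a ^+ 2 + a * - (a + b) + (- (a + b)) ^+ 2 = a ^+ 2 + a * b + b ^+ 2 by ring.
  have -> : a * - (a + b) * (a + - (a + b)) = a * b * (a + b) by ring.
  by move/le_trans; apply; rewrite lerD2r ler_norm.
- have [b1|b1] : 1 <= b \/ 1 <= - b by lia.
    have [c1|c1] : 1 <= a + b \/ 1 <= - (a + b) by lia.
      have := norm_le_pos a1 c1; rewrite -[`|_|]normrN.
      have -> : (- a) ^+ 2 + - a * (a + b) + (a + b) ^+ 2 = a ^+ 2 + a * b + b ^+ 2 by ring.
      have -> : - a * (a + b) * (- a + (a + b)) = - (a * b * (a + b)) by ring.
      by move/le_trans; apply; rewrite lerD2r ler_norm.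
    have := norm_le_pos b1 c1.
    have -> : b ^+ 2 + b * - (a + b) + (- (a + b)) ^+ 2 = a ^+ 2 + a * b + b ^+ 2 by ring.
    have -> : b * - (a + b) * (b + - (a + b)) = a * b * (a + b) by ring.
    by move/le_trans; apply; rewrite lerD2r ler_norm.
  have := norm_le_pos a1 b1; rewrite -[`|_|]normrN.
  have -> : (- a) ^+ 2 + - a * - b + (- b) ^+ 2 = a ^+ 2 + a * b + b ^+ 2 by ring.
  have -> : - a * - b * (- a + - b) = - (a * b * (a + b)) by ring.
  by move/le_trans; apply; rewrite lerD2r ler_norm.
Qed.

Lemma prim_denom_uniq m x y P : prim m x P -> prim m y P -> `|x.2|%N = `|y.2|%N.
Proof.
move=> [_ cx px] [_ cy py].
have [|c Ec] := @par_coprime x y cy.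
  by apply/par_ratv; apply: par_trans (@hvec_neq0 _) px (par_sym py).
have Ex1 : x.1.1 = c * y.1.1 by rewrite Ec; case: (y) => [[? ?] ?].
have Ex2 : x.1.2 = c * y.1.2 by rewrite Ec; case: (y) => [[? ?] ?].
have Ex3 : x.2 = c * y.2 by rewrite Ec; case: (y) => [[? ?] ?].
have : (c %| gcdz x.1.1 x.1.2)%Z by rewrite dvdz_gcd Ex1 Ex2 !dvdz_mulr.
by rewrite (eqP cx) dvdz1 Ex3 abszM => /eqP ->; rewrite mul1n.
Qed.

Lemma exists_prime_dvd (t : int) : 1 < `|t| -> exists2 p : nat, prime p & (p %| t)%Z.
Proof.
move=> t1; exists (pdiv `|t|); last by rewrite dvdzE pdiv_dvd.
by apply: pdiv_prime; rewrite -ltz_nat abszE.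
Qed.

Lemma three_primes (w : int) (p q r : nat) : w != 0 -> prime p -> prime q -> prime r ->
  (p %| w)%Z -> (q %| w)%Z -> (r %| w)%Z -> p != q -> p != r -> q != r ->
  (2 < size (primes `|w|%N))%N.
Proof.
move=> w0 pp pq pr dp dq dr pq' pr' qr'.
apply: (@uniq_leq_size _ [:: p; q; r]).
  by rewrite /= !inE !negb_or pq' pr' qr'.
move=> s; rewrite !inE mem_primes absz_gt0 w0.
rewrite !dvdzE /= in dp dq dr.
by case/or3P => /eqP ->; rewrite ?pp ?pq ?pr ?dp ?dq ?dr.
Qed.

Lemma units_of_product (u v : int) : u != 0 -> v != 0 -> `|u| * `|v| <= 1 ->
  `|u| = 1 /\ `|v| = 1.
Proof.
rewrite -!normr_gt0 !gtz0_ge1; move: (`|u|) (`|v|) => a b a1 b1 ab.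
by split; nia.
Qed.

Lemma cube_multiple_large (m w s : int) : m <> 0 -> 2 <= w -> m * w ^+ 3 = s ->
  `|s| <= 2 -> False.
Proof.
move=> /eqP; rewrite -normr_gt0 gtz0_ge1 => m1 w2 <-.
rewrite normrM normrX (ger0_norm (le_trans _ w2)) // => le2.
have w8 : 8 <= w ^+ 3 by rewrite !exprS expr0; nia.
by move: (w ^+ 3) (`|m|) w8 m1 le2 => c d; nia.
Qed.

Section Estimates.
Variable R : realFieldType.
Variable t : R.
Hypothesis t43 : 4 / 3 <= t.

Lemma four_thirds_ge1 : 1 <= t.
Proof. by move: t43; lra. Qed.

Lemma t_expn_ge1 k : 1 <= t ^+ k.
Proof. exact/exprn_ege1/four_thirds_ge1. Qed.

Lemma t5_ge4 : 4 <= t ^+ 5.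
Proof.
have t0 : 0 <= t := le_trans ler01 four_thirds_ge1.
apply: (@le_trans _ _ ((4 / 3) ^+ 5)); first by lra.
have c0 : 0 <= 4 / 3 :> R by lra.
exact: lerXn2r c0 t0 t43.
Qed.

Lemma chain_bounds (r s u : R) : 27 * r <= 4 * s -> s <= 729 * u -> r <= 108 * u.
Proof. lra. Qed.

Lemma cube_bound (r s : R) : 0 <= r -> r / 9 <= s -> r ^+ 3 <= 729 * s ^+ 3.
Proof.
move=> r0 rs; have s0 : 0 <= 9 * s by lra.
have -> : 729 * s ^+ 3 = (9 * s) ^+ 3 by ring.
by apply: lerXn2r => //; lra.
Qed.

(** Here n - 1 >= 8 t^4, and 64 t^5 > 108. *)
Lemma nine_t4_absurd (n : R) : 9 * t ^+ 4 <= n -> (n - 1) ^+ 2 <= 108 * t ^+ 3 -> False.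
Proof.
move=> n4 n2; have t4 := t_expn_ge1 4; have t3 := t_expn_ge1 3.
have : (8 * t ^+ 4) ^+ 2 <= (n - 1) ^+ 2.
  have a0 : 0 <= 8 * t ^+ 4 by lra.
  have b0 : 0 <= n - 1 by lra.
  by apply: lerXn2r => //; lra.
have -> : (8 * t ^+ 4) ^+ 2 = 64 * (t ^+ 5 * t ^+ 3) by ring.
have : 4 * t ^+ 3 <= t ^+ 5 * t ^+ 3 by rewrite ler_wpM2r ?t5_ge4 //; lra.
lra.
Qed.

(** Here n - 1 >= t^16 / 2, and t^29 >= (t^5)^5 >= 4^5 > 4 * 108. *)
Lemma t16_absurd (n : R) : t ^+ 16 <= n -> (n - 1) ^+ 2 <= 108 * t ^+ 3 -> False.
Proof.
move=> n4 n2; have t11 := t_expn_ge1 11; have t3 := t_expn_ge1 3.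
have t5 := t5_ge4.
have t16 : 2 <= t ^+ 16.
  have -> : t ^+ 16 = t ^+ 5 * t ^+ 11 by ring.
  have : 4 * 1 <= t ^+ 5 * t ^+ 11 by apply: ler_pM.
  lra.
have : (t ^+ 16 / 2) ^+ 2 <= (n - 1) ^+ 2.
  have a0 : 0 <= t ^+ 16 / 2 by lra.
  have b0 : 0 <= n - 1 by lra.
  by apply: lerXn2r => //; lra.
have -> : (t ^+ 16 / 2) ^+ 2 = (t ^+ 5) ^+ 5 * t ^+ 4 * t ^+ 3 / 4 by field.
have t25 : 1024 <= (t ^+ 5) ^+ 5.
  apply: (@le_trans _ _ (4 ^+ 5)); first by lra.
  have t50 : 0 <= t ^+ 5 by lra.
  have c0 : 0 <= 4 :> R by lra.
  exact: lerXn2r c0 t50 t5.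
have t4 := t_expn_ge1 4.
have : 1024 * 1 <= (t ^+ 5) ^+ 5 * t ^+ 4 by apply: ler_pM.
rewrite mulr1 => t29.
have : 1024 * t ^+ 3 <= (t ^+ 5) ^+ 5 * t ^+ 4 * t ^+ 3 by rewrite ler_wpM2r //; lra.
lra.
Qed.

Lemma expn4_gt n : (4 <= n)%N -> (3 * n < 4 ^ n.-1)%N.
Proof.
elim: n => // n IH; rewrite leq_eqVlt => /orP [/eqP <- //|n4].
have := IH n4; case: n n4 {IH} => // n n4; rewrite /= expnS; lia.
Qed.

(** The exponent n^2 - 1 is at least 5 (n - 1), and t^5 >= 4. *)
Lemma growth_absurd n : (4 <= n)%N -> t ^+ (n ^ 2) <= 3 * t * n%:R -> False.
Proof.
move=> n4; have t0 : 0 < t := lt_le_trans ltr01 four_thirds_ge1.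
have -> : (n ^ 2 = (5 * n.-1 + (n ^ 2 - 5 * n.-1).-1).+1)%N.
  by case: n n4 => // n n4; rewrite /= -mulnn; nia.
rewrite exprS mulrAC [X in _ <= X]mulrC (ler_pM2l t0) exprD exprM => le1.
have : (3 * n)%:R < (4 ^ n.-1)%:R :> R by rewrite ltr_nat expn4_gt.
rewrite natrM natrX; apply/negP; rewrite -leNgt; apply: le_trans le1.
rewrite -[X in X <= _]mulr1; have c0 : 0 <= 4 :> R by apply: ler0n.
apply: ler_pM (exprn_ge0 _ c0) ler01 _ (t_expn_ge1 _).
exact: lerXn2r c0 (le_trans c0 t5_ge4) t5_ge4.
Qed.

End Estimates.

Section Denominators.
Variable m : int.
Hypothesis m0 : m <> 0.
Hypothesis cfm : cube_free m.
Variable P : c'point.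
Hypothesis onP : on_c' m%:~R P.
Hypothesis ntP : nontorsion (tau P).
Let mul n := c'muln m%:~R n P.
Variable x : nat -> int * int * int.
Hypothesis Hx : forall n, prim m (x n) (mul n).
Variables U V W : nat -> int.
Hypothesis HW : forall n, (1 <= n)%N -> lowest_terms (cmuln n (tau P)) (U n) (V n) (W n).

Let mQ := intr_mQ_neq0 m0.
Local Notation N n := (norm_form (x n)).
Let h := ht (x 1%N).

Lemma lowest_mul n : (0 < n)%N -> lowest_terms (tau (mul n)) (U n) (V n) (W n).
Proof. by move=> n0; rewrite -(tau_mul m0 onP ntP); apply: HW. Qed.

Lemma norm_x_ge1 n : 1 <= N n.
Proof. exact: norm_ge1 (prim_primitive (Hx n)). Qed.

Lemma h_ge : 4 / 3 <= h.
Proof. exact: (ht1_ge m0 onP ntP Hx). Qed.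

Lemma h_ge1 : 1 <= h.
Proof. exact: four_thirds_ge1 h_ge. Qed.

Lemma ht_ge_pow n k : (k <= n ^ 2)%N -> h ^+ k <= ht (x n).
Proof.
move=> kn; apply: le_trans (ht_growth m0 onP Hx n).
have h1 := h_ge1.
by rewrite -/h -(subnKC kn) exprD ler_peMr ?exprn_ge0 ?exprn_ege1 //; apply: le_trans h1.
Qed.

(** If d_n = 1 or -1, then |m| = |ab(a+b)| >= N_n - 1 for the coordinates of nP,
    whereas 27 m^2 <= 4 N_1^3. *)
Lemma integral_bound n : `|(x n).2|%N = 1%N ->
  27 * (N n - 1) ^+ 2 <= 4 * N 1 ^+ 3.
Proof.
move=> dn; have D1 := disc_ge Hx 1.
have d1 : 1 <= (x 1%N).2 ^+ 6.
  have d0 := denom_neq0 m0 onP ntP Hx (isT : (0 < 1)%N).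
  rewrite -gtz0_ge1 lt0r exprn_even_ge0 // expf_neq0 //; exact/eqP.
apply: le_trans D1; apply: le_trans (_ : 27 * m ^+ 2 <= _); last first.
  by rewrite ler_peMr // mulr_ge0 ?sqr_ge0.
rewrite ler_pM2l //.
have N1 := norm_x_ge1 n.
have [Hc _ _] := Hx n; move: Hc dn N1; case: (x n) => [[a b] d] /= Hc dn N1.
have md : `|a * b * (a + b)| = `|m|.
  by rewrite Hc normrM normrX -[`|d|]abszE dn expr1n mulr1.
have := @norm_le_product a b; rewrite -normr_eq0 md normr_eq0.
move=> /(_ (introN eqP m0)) Nm.
rewrite -[m ^+ 2]real_normK ?num_real //.
rewrite ler_sqr ?nnegrE // ?subr_ge0 //.
by rewrite lerBlDr.
Qed.

Lemma integral_ht n : `|(x n).2|%N = 1%N ->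
  ((N n)%:~R - 1) ^+ 2 <= 108 * h ^+ 3.
Proof.
move=> /integral_bound; rewrite -(ler_int rat).
have -> : (27 * (N n - 1) ^+ 2)%:~R = 27 * ((N n)%:~R - 1) ^+ 2 :> rat by ring.
have -> : (4 * N 1 ^+ 3)%:~R = 4 * (N 1)%:~R ^+ 3 :> rat by ring.
move=> B.
have N0 k : 0 <= N k by apply: le_trans (norm_x_ge1 k).
have := ht_ge (N0 1%N); rewrite -/h => hN.
apply: chain_bounds B (cube_bound _ hN).
by rewrite ler0z.
Qed.

(** The denominator W_n is |d_n| times this integer or 3 times it, see [W_core];
    it is coprime to d_n. *)
Definition core n : int :=
  if (3 %| N n)%Z then (N n %/ 3)%Z else N n.
Local Notation T n := (core n).

Lemma ht_gt1 n : (0 < n)%N -> 1 < ht (x n).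
Proof.
move=> n0; apply: (@lt_le_trans _ _ h).
  by apply: lt_le_trans h_ge; rewrite ltr_pdivlMr ?ltr0n // mul1r ltr_nat.
by rewrite -[h]expr1; apply: ht_ge_pow; rewrite expn_gt0 n0.
Qed.

Lemma core_spec n : [/\ N n = (if (3 %| N n)%Z then 3 else 1) * T n,
  ~~ (3 %| T n)%Z & ht (x n) = (T n)%:~R / (if (3 %| N n)%Z then 3 else 1)].
Proof.
rewrite /core /ht; have [n3|n3] := boolP (3 %| N n)%Z; last by rewrite mul1r.
have [_ co _] := Hx n; have [s Es] := norm_dvd3_third co n3.
rewrite Es mulKz //; split=> //; first exact: ndvd3_1mod3.
by rewrite rmorphM /=; field.
Qed.

Lemma core_ge1 n : 1 <= T n.
Proof.
have [E _ _] := core_spec n; have := norm_x_ge1 n; rewrite E.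
by move: (T n) => t; case: ifP => _; lia.
Qed.

Lemma core_gt1 n : (0 < n)%N -> 1 < T n.
Proof.
move=> n0; have [_ _ E] := core_spec n; have := ht_gt1 n0; rewrite E -(ltr_int rat).
have : 1 <= (T n)%:~R :> rat by rewrite (ler_int rat 1) core_ge1.
by move: (_%:~R) => t; case: ifP => _ t1; rewrite ?divr1 //; lra.
Qed.

Lemma ht_le_core n : ht (x n) <= (T n)%:~R <= 3 * ht (x n).
Proof.
have [_ _ ->] := core_spec n.
have : 0 <= (T n)%:~R :> rat by rewrite ler0z; apply: le_trans (core_ge1 n).
by move: (_%:~R) => t t0; case: ifP => _; apply/andP; split; lra.
Qed.

Lemma W_core n : (0 < n)%N ->
  W n = `|(x n).2| * (if (3 %| N n)%Z then T n else 3 * T n).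
Proof.
move=> n0; have := denom_formula m0 cfm (Hx n) (lowest_mul n0).
have [E _ _] := core_spec n; case: ifP E => _ E EW; last by rewrite EW E mul1r.
by apply: (@mulfI _ 3) => //; rewrite EW E; ring.
Qed.

Lemma dvd_core_W n t : (0 < n)%N -> (t %| T n)%Z -> (t %| W n)%Z.
Proof.
by move=> n0 tT; rewrite W_core // dvdz_mull //; case: ifP => _ //; rewrite dvdz_mull.
Qed.

Lemma dvd_denom_W n t : (0 < n)%N -> (t %| (x n).2)%Z -> (t %| W n)%Z.
Proof.
by move=> n0 td; rewrite W_core // dvdz_mulr // dvdzE abszE.
Qed.

Lemma dvd_core_norm n t : (t %| T n)%Z -> (t %| N n)%Z.
Proof. by move=> tT; have [-> _ _] := core_spec n; rewrite dvdz_mull. Qed.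

Lemma prime_norm_core n (r : nat) : prime r -> r != 3%N -> (r %| N n)%Z -> (r %| T n)%Z.
Proof.
move=> pr r3; have [-> _ _] := core_spec n; rewrite Euclid_dvdzM // => /orP [|//].
case: ifP => _; rewrite dvdzE /=; first by rewrite dvdn_prime2 // (negPf r3).
by rewrite dvdn1 => /eqP E; rewrite E in pr.
Qed.

Lemma prime_core_denom n (r : nat) : prime r -> (r %| T n)%Z -> ~~ (r %| (x n).2)%Z.
Proof.
move=> pr /dvd_core_norm rN.
by case: (norm_prime_m pr (prim_primitive (Hx n)) rN).
Qed.

Lemma W_neq0 n : (0 < n)%N -> W n != 0.
Proof.
by move=> n0; have [_ W1 _] := HW n0; apply: lt0r_neq0; apply: lt_le_trans W1.
Qed.

Lemma denom_prime n : (0 < n)%N -> `|(x n).2|%N != 1%N ->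
  exists2 p : nat, prime p & (p %| (x n).2)%Z.
Proof.
move=> n0 d1; apply: exists_prime_dvd.
have d0 := denom_neq0 m0 onP ntP Hx n0.
by rewrite -abszE ltz_nat ltn_neqAle eq_sym d1 absz_gt0; apply/eqP.
Qed.

Lemma core_prime n : (0 < n)%N -> exists2 r : nat, prime r & (r %| T n)%Z.
Proof.
move=> n0; apply: exists_prime_dvd; apply: lt_le_trans (core_gt1 n0) (ler_norm _).
Qed.

(** The core exceeds 1 and is coprime to d_n. So d_n = 1 or -1, and 3 divides N_n
    because otherwise both 3 and a prime other than 3 divide W_n. Then N_n is at
    least 9 h^4, but integrality bounds it by a multiple of h^(3/2). *)
Lemma not_prime_power n : (1 < n)%N -> ~ prime_power (W n).
Proof.
move=> n1 [p [k [pp k0 EW]]]; have n0 : (0 < n)%N by apply: ltnW.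
have only (r : nat) : prime r -> (r %| W n)%Z -> r = p.
  move=> pr; rewrite EW dvdzE /= => rp; apply/eqP.
  by move: rp; rewrite Euclid_dvdX // dvdn_prime2 // => /andP [].
have [r pr rT] := core_prime n0; have rp := only r pr (dvd_core_W n0 rT).
have [n3|n3] := boolP (3 %| N n)%Z; last first.
  have := W_core n0; rewrite (negPf n3) => EW3.
  have E3 : 3%N = p by apply: only => //; rewrite EW3 dvdz_mull // dvdz_mulr.
  by have [_ /negP []] := core_spec n; rewrite -[3]/(3%N%:Z) E3 -rp.
have d1 : `|(x n).2|%N = 1%N.
  apply/eqP/negPn/negP => /(denom_prime n0) [s ps sd].
  have sp := only s ps (dvd_denom_W n0 sd).
  by have := prime_core_denom pr rT; rewrite rp -sp sd.
apply: (nine_t4_absurd h_ge) (integral_ht d1).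
have n4 : (4 <= n ^ 2)%N by rewrite -[4%N]/(2 ^ 2)%N leq_sqr.
have := ht_ge_pow n4; rewrite {1}/ht n3 => H.
by rewrite mulrC -ler_pdivlMr // ltr0n.
Qed.

Lemma triple_denom n : (0 < n)%N -> `|(x (n * 3)).2|%N = `|(U n * V n * W n)%R|%N.
Proof.
move=> n0; have := triple_prim m0 cfm (on_mul m0 onP n) (lowest_mul n0).
rewrite -c'mulnM // mulnC => H; exact: prim_denom_uniq (Hx (n * 3)%N) H.
Qed.

Lemma UVW_coprime n (r : nat) : (0 < n)%N -> prime r -> (r %| W n)%Z ->
  ~~ (r %| U n * V n)%Z.
Proof.
move=> n0 pr rW; have [co HF _] := lowest_coprime m0 cfm (on_mul m0 onP n) (lowest_mul n0).
have rF : (r %| U n ^+ 3 + V n ^+ 3)%Z.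
  by rewrite HF; apply: dvdz_mull; rewrite exprS; apply: dvdz_mulr.
have bad : (r %| U n)%Z -> (r %| V n)%Z -> False by apply: prime_coprimez.
rewrite Euclid_dvdzM //; apply/negP => /orP [rU|rV]; apply: bad => //.
  have : (r %| V n ^+ 3)%Z.
    have -> : V n ^+ 3 = 1 * (U n ^+ 3 + V n ^+ 3) + (- U n ^+ 2) * U n by ring.
    exact: dvdz_comb.
  by rewrite Euclid_dvdzX // andbT.
have : (r %| U n ^+ 3)%Z.
  have -> : U n ^+ 3 = 1 * (U n ^+ 3 + V n ^+ 3) + (- V n ^+ 2) * V n by ring.
  exact: dvdz_comb.
by rewrite Euclid_dvdzX // andbT.
Qed.

(** If U V = 1 or -1, then m W^3 = U^3 + V^3 has absolute value at most 2,
    although W > 1. *)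
Lemma UV_prime n : (0 < n)%N -> exists2 p : nat, prime p & (p %| U n * V n)%Z.
Proof.
move=> n0; have [co HF _] := lowest_coprime m0 cfm (on_mul m0 onP n) (lowest_mul n0).
have uvw0 : U n * V n * W n != 0.
  rewrite -absz_gt0 -triple_denom // absz_gt0; apply/eqP.
  by apply: (denom_neq0 m0 onP ntP Hx); rewrite muln_gt0 n0.
have W2 : 2 <= W n.
  have T1 := core_gt1 n0; have := W_core n0.
  have d1 : 1 <= `|(x n).2|.
    rewrite -gtz0_ge1 normr_gt0; apply/eqP; exact: (denom_neq0 m0 onP ntP Hx n0).
  move: (T n) (`|_|) T1 d1 => t d t1 d1 ->; case: ifP => _; nia.
apply: exists_prime_dvd; rewrite ltNge; apply/negP => UV1.
move: HF uvw0; rewrite mulf_eq0 negb_or mulf_eq0 negb_or /= => HF /andP [/andP [u0 v0] _].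
rewrite normrM in UV1; have [u1 v1] := units_of_product u0 v0 UV1.
apply: (cube_multiple_large m0 W2 (esym HF)).
by apply: le_trans (ler_normD _ _) _; rewrite !normrX u1 v1 !expr1n.
Qed.

Lemma uvw_logn n (r : nat) : (0 < n)%N -> prime r -> r != 3%N -> (r %| N n)%Z ->
  logn r `|(U n * V n * W n)%R| = logn r `|T n|.
Proof.
move=> n0 pr r3 rN; have rT := prime_norm_core pr r3 rN.
have rW := dvd_core_W n0 rT; have rUV := UVW_coprime n0 pr rW.
have rd := prime_core_denom pr rT.
have W0 := W_neq0 n0.
have UV0 : U n * V n != 0 by apply: contraNneq rUV => ->; apply: dvdz0.
have T0 : T n != 0 by apply: lt0r_neq0; apply: lt_le_trans (core_ge1 n).
have d0 : (x n).2 != 0 by apply: contraNneq rd => ->; apply: dvdz0.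
rewrite abszM lognM ?absz_gt0 // (logn_coprime (m := `|(U n * V n)%R|)); last first.
  by rewrite prime_coprime // -[_ %| _]dvdzE.
have Ld : logn r `|(x n).2| = 0%N by rewrite logn_coprime // prime_coprime.
have L3 : logn r 3 = 0%N by rewrite logn_prime // (negPf r3).
rewrite add0n W_core // abszM -abszE absz_nat.
case: ifP => _; last rewrite abszM; rewrite !lognM ?muln_gt0 ?absz_gt0 // Ld //.
by rewrite [logn r `|3|]L3.
Qed.

Lemma mul3_near (r : nat) : prime r -> r != 3%N -> (r %| N 1)%Z ->
  near_id r (V 1%N ^+ 3, U 1%N ^+ 3, U 1%N * V 1%N * W 1%N).
Proof.
move=> pr r3 rN; have rW := dvd_core_W (isT : (0 < 1)%N) (prime_norm_core pr r3 rN).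
have [_ HF _] := lowest_coprime m0 cfm (on_mul m0 onP 1) (lowest_mul (isT : (0 < 1)%N)).
split; rewrite /=; first exact: dvdz_mull.
by rewrite addrC HF; apply: dvdz_mull; rewrite exprS; apply: dvdz_mulr.
Qed.

Lemma mul3_prim : prim m (V 1%N ^+ 3, U 1%N ^+ 3, U 1%N * V 1%N * W 1%N) (mul 3).
Proof.
have := triple_prim m0 cfm (on_mul m0 onP 1) (lowest_mul (isT : (0 < 1)%N)).
by rewrite (mul1 m0 onP).
Qed.

Lemma mul_nontorsion k s : (0 < k)%N -> prim m s (mul k) -> s.2 != 0.
Proof.
move=> k0 ps; apply/eqP => s0; apply: (ntP k0).
by rewrite (tau_mul m0 onP ntP); apply: prim_infinite ps s0.
Qed.

(** The point 3P reduces to the identity modulo r, so nP reduces to P or to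
    -P. *)
Lemma norm_dvd_mul (r n : nat) : prime r -> r != 3%N -> ~~ (3 %| n)%N ->
  (r %| N 1)%Z -> (r %| N n)%Z.
Proof.
move=> pr r3 n3 rN.
have near3 k : (0 < k)%N -> near_id r (x (k * 3)).
  case: k => // k _; have t0 := @mul_nontorsion 3 _ isT mul3_prim.
  have pz := Hx (k.+1 * 3); rewrite /mul c'mulnM // in pz.
  by case: (near_mult m0 pr mul3_prim (mul3_near pr r3 rN) t0 pz).
have n1 := Hx 1%N.
have E := divn_eq n 3.
have [n31|n32] : (n %% 3 = 1)%N \/ (n %% 3 = 2)%N by rewrite /dvdn in n3; lia.
  have [k0|k0] := posnP (n %/ 3)%N; first by move: E; rewrite k0 n31 mul0n => ->.
  have := Hx n; rewrite E n31 addnC /mul c'mulnD // => pz.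
  exact: (near_norm m0 pr n1 (Hx _) (near3 _ k0) pz rN).
have E1 : (n + 1 = (n %/ 3).+1 * 3)%N by lia.
have := Hx n; rewrite /mul (mul_sub m0 onP n 1) E1.
have on_neg := on_opp (on_mul m0 onP 1).
rewrite (c'addC mQ (on_mul m0 onP _) on_neg).
move=> pz; apply: (near_norm m0 pr (prim_opp n1) (Hx _) (near3 _ (ltn0Sn _)) pz).
move: rN; case: (x 1%N) => [[a b] d]; rewrite /=.
by have -> : b ^+ 2 + b * a + a ^+ 2 = a ^+ 2 + a * b + b ^+ 2 by ring.
Qed.

(** Both valuations are read off from denominators: those of 3P and of
    3nP = n(3P), which are near the identity modulo r. *)
Lemma core_logn_le (r n : nat) : (0 < n)%N -> prime r -> ~~ (3 %| n)%N ->
  (r %| T 1)%Z -> (r %| T n)%Z /\ (logn r `|T n| <= logn r `|T 1| + logn r n)%N.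
Proof.
move=> n0 pr n3 rT1.
have r3 : r != 3%N.
  by apply: contraTneq rT1 => ->; have [_ + _] := core_spec 1.
have rN1 := dvd_core_norm rT1; have rNn := norm_dvd_mul pr r3 n3 rN1.
split; first exact: prime_norm_core.
rewrite -!uvw_logn //.
have pz : prim m (V n ^+ 3, U n ^+ 3, U n * V n * W n) (c'muln m%:~R n.-1.+1 (mul 3)).
  rewrite prednK // /mul -c'mulnM // mulnC c'mulnM //.
  exact: (triple_prim m0 cfm (on_mul m0 onP n) (lowest_mul n0)).
rewrite -[in X in (_ <= _ + X)%N](prednK n0).
apply: (near_logn m0 pr mul3_prim (mul3_near pr r3 rN1) _ cfm pz) => k t.
by rewrite /mul -c'mulnM //; apply: mul_nontorsion.
Qed.

(** If n = 3k, then d_n = U_k V_k W_k up to sign, and the coprime integers W_k,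
    U_k V_k and the core of N_n provide three primes. If 3 does not divide n, a
    prime p divides d_n, and every prime r dividing the core T_1 also divides T_n;
    were there no further prime, T_n would be a power of r, hence at most n T_1 by
    [core_logn_le], against the growth of the height. *)
Lemma three_prime_divisors n : (4 <= n)%N -> (2 < size (primes `|W n|%N))%N.
Proof.
move=> n4; have n0 : (0 < n)%N by apply: leq_trans n4.
have d1 : `|(x n).2|%N != 1%N.
  apply/eqP => /integral_ht B.
  have n16 : (16 <= n ^ 2)%N by rewrite -[16%N]/(4 ^ 2)%N leq_sqr.
  apply: (t16_absurd h_ge) B; apply: le_trans (ht_ge_pow n16) _.
  by apply: ht_le; apply: le_trans (norm_x_ge1 n).
have W0 := W_neq0 n0.
have [n3|n3] := boolP (3 %| n)%N.
  have [k En] := dvdnP n3; have k0 : (0 < k)%N by case: k En n4 => // ->.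
  have dE := triple_denom k0; rewrite -En in dE.
  have dvd_d (p : nat) : (p %| U k * V k * W k)%Z -> (p %| (x n).2)%Z.
    by rewrite !dvdzE dE.
  have [p1 pp1 p1T] := core_prime k0; have p1W := dvd_core_W k0 p1T.
  have [p2 pp2 p2UV] := UV_prime k0.
  have [p3 pp3 p3T] := core_prime n0; have p3d := prime_core_denom pp3 p3T.
  have p1d : (p1 %| (x n).2)%Z by apply: dvd_d; apply: dvdz_mull.
  have p2d : (p2 %| (x n).2)%Z by apply: dvd_d; apply: dvdz_mulr.
  apply: (three_primes W0 pp1 pp2 pp3).
  - exact: dvd_denom_W.
  - exact: dvd_denom_W.
  - exact: dvd_core_W.
  - by apply: contraTneq p2UV => <-; apply: UVW_coprime.
  - by apply: contraTneq p1d => ->.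
  - by apply: contraTneq p2d => ->.
rewrite ltnNge; apply/negP => small.
have [p pp pd] := denom_prime n0 d1.
have [r pr rT1] := core_prime (isT : (0 < 1)%N).
have [rTn vr] := core_logn_le n0 pr n3 rT1.
have pnT (s : nat) : prime s -> (s %| T n)%Z -> p != s.
  by move=> ps sT; apply: contraTneq pd => ->; apply: prime_core_denom.
have onlyr (s : nat) : prime s -> (s %| T n)%Z -> s = r.
  move=> ps sT; apply/eqP/negPn/negP => sr; move: small; apply/negP; rewrite -ltnNge.
  apply: (three_primes W0 pp ps pr) => //; do ?exact: pnT.
  - exact: dvd_denom_W.
  - exact: dvd_core_W.
  - exact: dvd_core_W.
have T0 k : (0 < `|T k|)%N by rewrite absz_gt0 lt0r_neq0 // (lt_le_trans _ (core_ge1 k)).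
have TnE : `|T n|%N = (r ^ logn r `|T n|)%N.
  have : r.-nat `|T n|%N.
    by apply/pnatP => // l pl lT; rewrite (onlyr l) ?inE // dvdzE.
  by move=> /part_pnat_id {1}<-; rewrite p_part.
have Tle : (`|T n| <= `|T 1| * n)%N.
  rewrite TnE (leq_trans (leq_pexp2l (prime_gt0 pr) vr)) // expnD.
  by apply: leq_mul; apply: dvdn_leq => //; exact: pfactor_dvdnn.
apply: (growth_absurd h_ge n4).
apply: le_trans (ht_growth m0 onP Hx n) _.
have [/andP [Ln _] /andP [_ L1]] := (ht_le_core n, ht_le_core 1).
apply: le_trans Ln _; apply: le_trans (_ : (T 1)%:~R * n%:R <= _); last first.
  by rewrite ler_wpM2r ?ler0n.
have absT k : (T k)%:~R = (`|T k|%N)%:R :> rat.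
  by rewrite -[LHS]/(_%:~R) -{1}[T k]gez0_abs ?(le_trans _ (core_ge1 k)).
by rewrite !absT -natrM ler_nat.
Qed.

End Denominators.

Local Open Scope classical_set_scope.
Local Open Scope card_scope.
Local Open Scope ring_scope.

Theorem theorem1p2 :
  (forall (m : int) (R : cpoint) (U V W : nat -> int),
     m <> 0 -> cube_free m -> on_C m R -> nontorsion R -> in_tau_image m R ->
     (forall n : nat, (1 <= n)%N ->
        lowest_terms (cmuln n R) (U n) (V n) (W n)) ->
     forall n : nat, (1 < n)%N -> ~ prime_power (W n))
  /\
  (exists K : nat,
     forall (m : int) (R : cpoint) (U V W : nat -> int),
     m <> 0 -> cube_free m -> on_C m R -> nontorsion R -> in_tau_image m R ->
     (forall n : nat, (1 <= n)%N ->
        lowest_terms (cmuln n R) (U n) (V n) (W n)) ->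
     [set n : nat | (1 <= n)%N /\ (size (primes `|W n|%N) <= 2)%N] #<= `I_K).
Proof.
have mult_prim (m : int) (P : c'point) : m <> 0 -> cube_free m -> on_C' m P ->
    exists x, forall n, prim m (x n) (c'muln m%:~R n P).
  move=> m0 cfm /on_C'_on_c' onP.
  have [x Hx] := boolp.choice (fun n => prim_exists cfm (on_muln (intr_mQ_neq0 m0) n onP)).
  by exists x.
split.
  move=> m R U V W m0 cfm _ + [P onP E]; rewrite -E => ntP HW n n1.
  have [x Hx] := mult_prim m P m0 cfm onP.
  exact: (not_prime_power m0 cfm (on_C'_on_c' onP) ntP Hx HW n1).
exists 4%N => m R U V W m0 cfm _ + [P onP E]; rewrite -E => ntP HW.
have [x Hx] := mult_prim m P m0 cfm onP.
apply: subset_card_le => n /= [_ small]; rewrite ltnNge; apply/negP => n4.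
have := three_prime_divisors m0 cfm (on_C'_on_c' onP) ntP Hx HW n4.
by rewrite ltnNge small.
Qed.
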